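(* Let $p$ be an odd prime, $K$ an algebraically closed field of characteristic zero, and let $H=H_p$ be Nikshych's Hopf algebra over $K$. The Hopf algebras $H$ and $H^*$ are isomorphic.
   Context: Nikshych's Hopf algebra $H=H_p$ over $K$: fix a primitive $p$-th root of unity $\zeta\in K$. As a $K$-algebra $H$ is generated by $e_0,e_1,u_a,u_b,v_a,v_b,g$ with defining relations $e_0+e_1=1$, $e_0e_1=e_1e_0=0$; $u_a^p=u_b^p=e_0$, $e_0u_a=u_a$, $e_0u_b=u_b$, $u_au_b=u_bu_a$; $v_a^p=v_b^p=e_1$, $e_1v_a=v_a$, $e_1v_b=v_b$, $v_av_b=\zeta v_bv_a$; $g^2=1$, $gu_a=u_bg$, $gu_b=u_ag$, $gv_a=v_ag$, $gv_b=v_bg$. Its Hopf structure is: $\Delta(u_a)=u_a\otimes u_a+v_a\otimes v_a$, $\Delta(u_b)=u_b\otimes u_b+v_b\otimes v_b^{p-1}$, $\Delta(v_a)=u_a\otimes v_a+v_a\otimes u_a$, $\Delta(v_b)=u_b\otimes v_b+v_b\otimes u_b^{p-1}$; $\varepsilon(u_a)=\varepsilon(u_b)=1$, $\varepsilon(v_a)=\varepsilon(v_b)=0$; $S(u_a)=u_a^{p-1}$, $S(u_b)=u_b^{p-1}$, $S(v_a)=v_a^{p-1}$, $S(v_b)=v_b$; $\varepsilon(g)=1$, $S(g)=g$, and $$\Delta(g)=\tfrac{1}{p^2}\sum_{i,j,k,l}\zeta^{kj-il}gu_a^iu_b^j\otimes gu_a^ku_b^l+\tfrac1p\sum_{k,l}\zeta^{-(k+l)k}gu_a^ku_b^l\otimes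 gv_a^{k+l}v_b^{k+l}+\tfrac1p\sum_{k,l}\zeta^{k(k+l)}gv_a^{k+l}v_b^{(p-1)(k+l)}\otimes gu_a^ku_b^l+\tfrac1p\sum_{k,l}gv_a^kv_b^l\otimes gv_a^{(p-1)l}v_b^k,$$ indices running from $0$ to $p-1$, with $u_a^0=u_b^0=e_0$, $v_a^0=v_b^0=e_1$. It has dimension $4p^2$. $H^*$ is the dual Hopf algebra of $H$. *)

(* Defs.v *)
From HB Require Import structures.
From mathcomp Require Import all_boot all_order all_algebra all_field.

Set Implicit Arguments.
Unset Strict Implicit.
Unset Printing Implicit Defensive.

Import GRing.Theory.
Import VectorInternalTheory.

Local Open Scope ring_scope.

Reserved Notation "u '\ox' v" (at level 45, left associativity).

Section TensorSpace.
Variable K : fieldType.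

(* Tensor product of finite-dimensional spaces, as coefficient matrices over
   the product of the reference bases [vecb] of [U] and [V].  Its universal
   property is given by [tens_liftE] (existence) and [tens_ind]
   (uniqueness). *)
Definition tens (U V : vectType K) : Type :=
  'M[K]_(dim U, dim V).

HB.instance Definition _ (U V : vectType K) := Vector.on (tens U V).

Definition tensv (U V : vectType K) (u : U) (v : V) : tens U V :=
  (v2r u)^T *m v2r v.

Definition vecb (U : vectType K) (i : 'I_(dim U)) : U :=
  r2v (delta_mx 0 i).

Definition tens_lift (U V : vectType K) (W : lmodType K) (f : U -> V -> W)
    (t : tens U V) : W :=
  \sum_i \sum_j t i j *: f (vecb i) (vecb j).

Section Theory.
Variables (U V : vectType K).
Implicit Types (u : U) (v : V) (W : lmodType K).

Lemma tensv_bilinear : bilinear_for *:%R *:%R (@tensv U V).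
Proof.
split=> [v|u] a x y; rewrite /tensv linearP.
  by rewrite linearP mulmxDl -scalemxAl.
by rewrite linearP.
Qed.

Lemma tensvDl v u1 u2 : tensv (u1 + u2) v = tensv u1 v + tensv u2 v.
Proof. by have := tensv_bilinear.1 v 1 u1 u2 => /=; rewrite !scale1r. Qed.
Lemma tensvDr u v1 v2 : tensv u (v1 + v2) = tensv u v1 + tensv u v2.
Proof. by have := tensv_bilinear.2 u 1 v1 v2 => /=; rewrite !scale1r. Qed.
Lemma tensv0l v : tensv 0 v = 0 :> tens U V.
Proof. by rewrite /tensv linear0 trmx0 mul0mx. Qed.
Lemma tensv0r u : tensv u 0 = 0 :> tens U V.
Proof. by rewrite /tensv linear0 mulmx0. Qed.
Lemma tensvZl a u v : tensv (a *: u) v = a *: tensv u v.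
Proof. by have := tensv_bilinear.1 v a u 0 => /=; rewrite !addr0 tensv0l addr0. Qed.
Lemma tensvZr a u v : tensv u (a *: v) = a *: tensv u v.
Proof. by have := tensv_bilinear.2 u a v 0 => /=; rewrite !addr0 tensv0r addr0. Qed.

Lemma tens_lift_is_linear W (f : U -> V -> W) : linear (tens_lift f).
Proof.
move=> a s t; rewrite /tens_lift scaler_sumr -big_split /=.
apply: eq_bigr => i _; rewrite scaler_sumr -big_split /=.
by apply: eq_bigr => j _; rewrite !mxE scalerDl scalerA.
Qed.
HB.instance Definition _ W (f : U -> V -> W) :=
  GRing.isLinear.Build K (tens U V) W *:%R (tens_lift f)
    (tens_lift_is_linear f).

Lemma vecb_coord (X : vectType K) (x : X) : x = \sum_i v2r x 0 i *: vecb i.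
Proof.
rewrite -[LHS]v2rK [v2r x in LHS]row_sum_delta linear_sum /=.
by apply: eq_bigr => i _; rewrite linearZ.
Qed.

Lemma v2r_vecb_sum (X : vectType K) (c : 'I_(dim X) -> K) j :
  v2r (\sum_i c i *: vecb i : X) 0 j = c j.
Proof.
rewrite linear_sum summxE (bigD1 j) //= linearZ /= r2vK !mxE !eqxx mulr1.
rewrite big1 ?addr0 // => i ij.
by rewrite linearZ /= r2vK !mxE eq_sym (negbTE ij) mulr0.
Qed.

Lemma tens_liftE W (f : U -> V -> W) u v :
  bilinear_for *:%R *:%R f -> tens_lift f (tensv u v) = f u v.
Proof.
move=> [fl fr].
pose gl w : {linear U -> W} := HB.pack (f^~ w)
  (GRing.isLinear.Build K U W *:%R (f^~ w) (fl w)).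
pose gr w : {linear V -> W} := HB.pack (f w)
  (GRing.isLinear.Build K V W *:%R (f w) (fr w)).
rewrite {2}(vecb_coord u) -[RHS]/(gl v _) linear_sum.
apply: eq_bigr => i _; rewrite linearZ /= {2}(vecb_coord v).
rewrite -[f _ (\sum__ _)]/(gr (vecb i) _) linear_sum scaler_sumr.
apply: eq_bigr => j _; rewrite linearZ scalerA; congr (_ *: _).
by rewrite /tensv !mxE big_ord1 !mxE.
Qed.

Lemma tens_basis (t : tens U V) :
  t = \sum_i \sum_j t i j *: tensv (vecb i) (vecb j).
Proof.
rewrite [LHS]matrix_sum_delta; apply: eq_bigr => i _; apply: eq_bigr => j _.
congr (_ *: _); rewrite /tensv /vecb !r2vK.
by apply/matrixP => a b; rewrite !mxE big_ord1 !mxE mulr_natr -mulrnA mulnb andbC.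
Qed.

Lemma tens_ind (P : tens U V -> Prop) :
    (forall u v, P (tensv u v)) -> (forall s t, P s -> P t -> P (s + t)) ->
  forall t, P t.
Proof.
move=> Pv PD t.
have P0 : P 0 by rewrite -(tensv0l 0).
by rewrite (tens_basis t); apply: (big_ind P) => // i _; apply: (big_ind P) => // j _;
  rewrite -tensvZl.
Qed.

Lemma tensv_neq0 u v : u != 0 -> v != 0 -> tensv u v != 0.
Proof.
have nz (X : vectType K) (x : X) : x != 0 -> exists i, v2r x 0 i != 0.
  move=> x0; apply/existsP; apply: contraNT x0 => /existsPn z.
  rewrite (vecb_coord x) big1 // => i _.
  by move: (z i); rewrite negbK => /eqP ->; rewrite scale0r.
move=> /nz[i ui] /nz[j vj]; apply/eqP => /matrixP/(_ i j).
rewrite /tensv !mxE big_ord1 !mxE => /eqP.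
by rewrite mulf_eq0 (negbTE ui) (negbTE vj).
Qed.

End Theory.

Definition tens_map (U V U' V' : vectType K) (f : U -> U') (g : V -> V') :
    tens U V -> tens U' V' :=
  tens_lift (fun u v => tensv (f u) (g v)).
HB.instance Definition _ (U V U' V' : vectType K) (f : U -> U') (g : V -> V') :=
  GRing.Linear.on (@tens_map U V U' V' f g).

Definition tens_assoc (U V W : vectType K) :
    tens U (tens V W) -> tens (tens U V) W :=
  tens_lift (fun u => tens_lift (fun v w => tensv (tensv u v) w)).
HB.instance Definition _ (U V W : vectType K) := GRing.Linear.on (@tens_assoc U V W).

(* The functional u (x) v |-> f u * g v. *)
Definition tens_form (U V : vectType K) (f : U -> K^o) (g : V -> K^o) :
    tens U V -> K^o :=
  tens_lift (fun u v => f u * g v : K^o).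
HB.instance Definition _ (U V : vectType K) (f : U -> K^o) (g : V -> K^o) :=
  GRing.Linear.on (@tens_form U V f g).

Section MapTheory.
Variables (U V U' V' W : vectType K).

Lemma tens_mapE (f : {linear U -> U'}) (g : {linear V -> V'}) u v :
  tens_map f g (tensv u v) = tensv (f u) (g v).
Proof.
rewrite /tens_map tens_liftE //; split=> [y|x] a z w; rewrite linearP.
  by rewrite tensvDl tensvZl.
by rewrite tensvDr tensvZr.
Qed.

Lemma tens_formE (f : {linear U -> K^o}) (g : {linear V -> K^o}) u v :
  tens_form f g (tensv u v) = f u * g v.
Proof.
rewrite /tens_form tens_liftE //; split=> [y|x] a z w; rewrite linearP.
  by rewrite mulrDl -scalerAl.
by rewrite mulrDr -scalerAr.
Qed.

Lemma tens_lift_linear_arg (X : lmodType K) (f : W -> U -> V -> X) t :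
  (forall u v, linear (fun w => f w u v)) ->
  linear (fun w => tens_lift (f w) t).
Proof.
move=> fl a x y; rewrite /tens_lift scaler_sumr -big_split /=.
apply: eq_bigr => i _; rewrite scaler_sumr -big_split /=.
by apply: eq_bigr => j _; rewrite fl scalerDr !scalerA mulrC.
Qed.

End MapTheory.

Lemma tens_assocE (U V W : vectType K) (u : U) (v : V) (w : W) :
  tens_assoc (tensv u (tensv v w)) = tensv (tensv u v) w.
Proof.
rewrite /tens_assoc tens_liftE; last first.
  split=> [t|x]; last exact: tens_lift_is_linear.
  apply: tens_lift_linear_arg => v' w' a x y.
  by rewrite tensvDl tensvZl tensvDl tensvZl.
rewrite tens_liftE //; split=> [y|x] a z t; last by rewrite tensvDr tensvZr.
by rewrite tensvDr tensvZr tensvDl tensvZl.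
Qed.

(* Separating families of functionals on the factors separate the product. *)
Lemma tens_sep (U V : vectType K) (I J : Type)
    (phi : I -> {linear U -> K^o}) (psi : J -> {linear V -> K^o}) :
    (forall u, (forall i, phi i u = 0) -> u = 0) ->
    (forall v, (forall j, psi j v = 0) -> v = 0) ->
  forall s t : tens U V,
    (forall i j, tens_form (phi i) (psi j) s = tens_form (phi i) (psi j) t) ->
  s = t.
Proof.
move=> sU sV s t st; apply/eqP; rewrite -subr_eq0; apply/eqP.
have {st}: forall i j, tens_form (phi i) (psi j) (s - t) = 0.
  by move=> i j; rewrite linearB /= st subrr.
move: (s - t) => {s t} r r0.
have r0' j : \sum_i r i j *: vecb i = 0.
  apply: sU => i; rewrite linear_sum /=.
  pose w : V := \sum_j' (\sum_i' r i' j' * phi i (vecb i')) *: vecb j'.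
  have w0 : w = 0.
    apply: sV => k; rewrite /w linear_sum -[RHS](r0 i k) /tens_form /tens_lift.
    rewrite exchange_big; apply: eq_bigr => j' _; rewrite linearZ /=.
    rewrite /GRing.scale /= mulr_suml; apply: eq_bigr => i' _.
    by rewrite mulrA.
  move/(congr1 v2r)/matrixP/(_ 0 j): w0.
  rewrite linear0 [in RHS]mxE v2r_vecb_sum => wj.
  by rewrite -[RHS]wj; apply: eq_bigr => i' _; rewrite linearZ.
apply/matrixP => i j; rewrite mxE.
move/(congr1 v2r)/matrixP/(_ 0 i): (r0' j).
by rewrite linear0 [in RHS]mxE v2r_vecb_sum.
Qed.

End TensorSpace.

Notation "u \ox v" := (tensv u v) : ring_scope.

Section TensorAlgebra.
Variables (K : fieldType) (A B : falgType K).
Implicit Types (s t r : tens A B) (a c : A) (b d : B).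

Definition tens_one : tens A B := tensv 1 1.
Definition tens_mul t s : tens A B :=
  tens_lift (fun a b => tens_lift (fun c d => tensv (a * c) (b * d)) s) t.

Lemma tens_mul_linearl s : linear (tens_mul^~ s).
Proof. exact: tens_lift_is_linear. Qed.

Lemma tens_mul_linearr t : linear (tens_mul t).
Proof.
apply: (tens_lift_linear_arg
  (f := fun s a b => tens_lift (fun c d => tensv (a * c) (b * d)) s)) => a b.
exact: tens_lift_is_linear.
Qed.

Lemma tens_mulv a b c d :
  tens_mul (tensv a b) (tensv c d) = tensv (a * c) (b * d).
Proof.
rewrite /tens_mul tens_liftE.
  rewrite tens_liftE //; split=> [y|x] k z w.
    by rewrite mulrDr tensvDl -scalerAr tensvZl.
  by rewrite mulrDr tensvDr -scalerAr tensvZr.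
split=> [y|x].
  apply: (tens_lift_linear_arg (f := fun a c d => tensv (a * c) (y * d))).
  by move=> u v k z w; rewrite mulrDl tensvDl -scalerAl tensvZl.
apply: (tens_lift_linear_arg (f := fun b c d => tensv (x * c) (b * d))).
by move=> u v k z w; rewrite mulrDl tensvDr -scalerAl tensvZr.
Qed.

Lemma tens_mulDl : left_distributive tens_mul +%R.
Proof.
by move=> r s t; have /= := tens_mul_linearl t 1 r s; rewrite !scale1r.
Qed.

Lemma tens_mulDr : right_distributive tens_mul +%R.
Proof.
by move=> r s t; have /= := tens_mul_linearr r 1 s t; rewrite !scale1r.
Qed.

Lemma tens_mulZl k s t : k *: tens_mul s t = tens_mul (k *: s) t.
Proof. by have /= -> := scalable_linear (tens_mul_linearl t) k s. Qed.

Lemma tens_mulZr k s t : k *: tens_mul s t = tens_mul s (k *: t).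
Proof. by have /= -> := scalable_linear (tens_mul_linearr s) k t. Qed.

Lemma tens_mulA : associative tens_mul.
Proof.
move=> r s t; elim/tens_ind: r => [a b|x y ihx ihy]; last first.
  by rewrite !tens_mulDl ihx ihy.
elim/tens_ind: s => [c d|x y ihx ihy]; last first.
  by rewrite tens_mulDl !tens_mulDr tens_mulDl ihx ihy.
elim/tens_ind: t => [e f|x y ihx ihy]; last by rewrite !tens_mulDr ihx ihy.
by rewrite !tens_mulv !mulrA.
Qed.

Lemma tens_mul1 : left_id tens_one tens_mul.
Proof.
elim/tens_ind => [a b|x y ihx ihy]; last by rewrite tens_mulDr ihx ihy.
by rewrite tens_mulv !mul1r.
Qed.

Lemma tens_mulr1 : right_id tens_one tens_mul.
Proof.
elim/tens_ind => [a b|x y ihx ihy]; last by rewrite tens_mulDl ihx ihy.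
by rewrite tens_mulv !mulr1.
Qed.

Lemma tens_one_neq0 : tens_one != 0.
Proof. by apply: tensv_neq0; apply: oner_neq0. Qed.

HB.instance Definition _ := GRing.Zmodule_isNzRing.Build (tens A B)
  tens_mulA tens_mul1 tens_mulr1 tens_mulDl tens_mulDr tens_one_neq0.
HB.instance Definition _ :=
  GRing.Lmodule_isLalgebra.Build K (tens A B) tens_mulZl.
HB.instance Definition _ :=
  GRing.Lalgebra_isAlgebra.Build K (tens A B) tens_mulZr.
HB.instance Definition _ := Algebra_isFalgebra.Build K (tens A B).

Lemma tensvM a b c d :
  tensv a b * tensv c d = tensv (a * c) (b * d) :> tens A B.
Proof. exact: tens_mulv. Qed.

Lemma tensv1 : tensv 1 1 = 1 :> tens A B.
Proof. by []. Qed.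

End TensorAlgebra.

HB.mixin Record Falgebra_isHopfAlgebra (K : fieldType) H of Falgebra K H := {
  comul : {lrmorphism H -> tens H H};
  counit : {lrmorphism H -> K^o};
  antipode : {linear H -> H};
  comulA : forall x : H, tens_assoc (tens_map idfun comul (comul x)) =
                         tens_map comul idfun (comul x);
  counitl : forall x : H,
    tens_lift (fun y z => (counit y : K) *: z) (comul x) = x;
  counitr : forall x : H,
    tens_lift (fun y z => (counit z : K) *: y) (comul x) = x;
  antipodel : forall x : H,
    tens_lift (fun y z => antipode y * z) (comul x) = (counit x : K) *: 1;
  antipoder : forall x : H,
    tens_lift (fun y z => y * antipode z) (comul x) = (counit x : K) *: 1
}.

#[short(type="hopfType")]
HB.structure Definition HopfAlgebra (K : fieldType) :=
  { H of Falgebra_isHopfAlgebra K H & Falgebra K H }.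

Arguments comul {K s} : rename.
Arguments counit {K s} : rename.
Arguments antipode {K s} : rename.

Definition hopf_isomorphic (K : fieldType) (H H' : hopfType K) : Prop :=
  exists f : {lrmorphism H -> H'},
    [/\ bijective f,
        forall x, comul (f x) = tens_map f f (comul x),
        forall x, counit (f x) = counit x
      & forall x, antipode (f x) = f (antipode x)].

Section DualHopf.
Variables (K : fieldType).

Definition hdual (H : hopfType K) : Type := 'Hom(H, K^o).

Variable H : hopfType K.
Implicit Types (f g h : hdual H) (x y z : H).

HB.instance Definition _ := Vector.on (hdual H).

Definition hdual_of (F : {linear H -> K^o}) : hdual H := linfun F.

Lemma hdual_ofE (F : {linear H -> K^o}) x : hdual_of F x = F x.
Proof. exact: lfunE. Qed.

Lemma hdualP f g : f =1 g -> f = g.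
Proof. by move=> fg; apply/lfunP. Qed.

Lemma hdualD f g x : (f + g) x = f x + g x.
Proof. exact: add_lfunE. Qed.

Lemma hdualZ k f x : (k *: f) x = k * f x.
Proof. exact: scale_lfunE. Qed.

Lemma hdual_linZ f k x : f (k *: x) = k * f x.
Proof. exact: linearZ. Qed.

Lemma hdual0 x : (0 : hdual H) x = 0.
Proof. exact: zero_lfunE. Qed.

Lemma hdual_sum I (r : seq I) (P : pred I) (F : I -> hdual H) x :
  (\sum_(i <- r | P i) F i) x = \sum_(i <- r | P i) F i x.
Proof. exact: sum_lfunE. Qed.

Definition hdual_one : hdual H := hdual_of (@counit K H).

(* Convolution product: [(f * g) x] is the sum of the [f x' * g x''] over
   [comul x = x' (x) x'']. *)
Definition hdual_mul f g : hdual H := hdual_of (tens_form f g \o @comul K H).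

Lemma hdual_mulE f g x : hdual_mul f g x = tens_form f g (comul x).
Proof. exact: hdual_ofE. Qed.

Lemma tens_formDl (U V : vectType K) (f1 f2 : U -> K^o) (g : V -> K^o) t :
  tens_form (fun u => f1 u + f2 u) g t = tens_form f1 g t + tens_form f2 g t.
Proof.
rewrite /tens_form /tens_lift -big_split; apply: eq_bigr => i _.
by rewrite -big_split; apply: eq_bigr => j _; rewrite mulrDl scalerDr.
Qed.

Lemma tens_formDr (U V : vectType K) (f : U -> K^o) (g1 g2 : V -> K^o) t :
  tens_form f (fun v => g1 v + g2 v) t = tens_form f g1 t + tens_form f g2 t.
Proof.
rewrite /tens_form /tens_lift -big_split; apply: eq_bigr => i _.
by rewrite -big_split; apply: eq_bigr => j _; rewrite mulrDr scalerDr.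
Qed.

Lemma tens_formZl (U V : vectType K) (k : K) (f : U -> K^o) (g : V -> K^o) t :
  tens_form (fun u => k * f u) g t = k * tens_form f g t.
Proof.
rewrite /tens_form /tens_lift mulr_sumr; apply: eq_bigr => i _.
rewrite mulr_sumr; apply: eq_bigr => j _.
by rewrite /GRing.scale /= -[k * _ * _]mulrA mulrCA.
Qed.

Lemma tens_formZr (U V : vectType K) (k : K) (f : U -> K^o) (g : V -> K^o) t :
  tens_form f (fun v => k * g v) t = k * tens_form f g t.
Proof.
rewrite /tens_form /tens_lift mulr_sumr; apply: eq_bigr => i _.
rewrite mulr_sumr; apply: eq_bigr => j _.
by rewrite /GRing.scale /= [f _ * _]mulrCA; exact: mulrCA.
Qed.

Lemma eq_tens_form (U V : vectType K) (f f' : U -> K^o) (g g' : V -> K^o) :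
  f =1 f' -> g =1 g' -> tens_form f g =1 tens_form f' g'.
Proof.
move=> ff gg t; apply: eq_bigr => i _; apply: eq_bigr => j _.
by rewrite ff gg.
Qed.

Lemma tens_form_map (U V U' V' : vectType K) (a : {linear U -> U'})
    (b : {linear V -> V'}) (f : {linear U' -> K^o}) (g : {linear V' -> K^o}) t :
  tens_form f g (tens_map a b t) = tens_form (f \o a) (g \o b) t.
Proof.
elim/tens_ind: t => [u v|s t ihs iht]; last by rewrite !linearD /= ihs iht.
by rewrite tens_mapE !tens_formE.
Qed.

Lemma tens_form_assoc (U V W : vectType K) (f : {linear U -> K^o})
    (g : {linear V -> K^o}) (h : {linear W -> K^o}) t :
  tens_form (tens_form f g) h (tens_assoc t) =
  tens_form f (tens_form g h) t.
Proof.
elim/tens_ind: t => [u v|s t ihs iht]; last by rewrite !linearD /= ihs iht.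
elim/tens_ind: v => [v w|s t ihs iht].
  rewrite tens_assocE; do 4!rewrite tens_formE /=. by rewrite -mulrA.
by rewrite tensvDr !linearD /= ihs iht.
Qed.

Lemma hdual_mulA : associative hdual_mul.
Proof.
move=> f g h; apply: hdualP => x; rewrite !hdual_mulE.
transitivity (tens_form (tens_form f g) h
    (tens_assoc (tens_map idfun comul (comul x)))).
  rewrite tens_form_assoc tens_form_map.
  by apply: eq_tens_form => y //=; rewrite hdual_mulE.
rewrite comulA tens_form_map.
by apply: eq_tens_form => y //=; rewrite hdual_mulE.
Qed.

Lemma hdual_mul1 : left_id hdual_one hdual_mul.
Proof.
move=> f; apply: hdualP => x; rewrite hdual_mulE -[in RHS](counitl x).
rewrite /tens_form /tens_lift linear_sum; apply: eq_bigr => i _.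
rewrite linear_sum; apply: eq_bigr => j _.
by rewrite /= !hdual_linZ hdual_ofE.
Qed.

Lemma hdual_mulr1 : right_id hdual_one hdual_mul.
Proof.
move=> f; apply: hdualP => x; rewrite hdual_mulE -[in RHS](counitr x).
rewrite /tens_form /tens_lift linear_sum; apply: eq_bigr => i _.
rewrite linear_sum; apply: eq_bigr => j _.
by rewrite /= !hdual_linZ hdual_ofE [f _ * _]mulrC.
Qed.

Lemma hdual_mulDl : left_distributive hdual_mul +%R.
Proof.
move=> f g h; apply: hdualP => x; rewrite hdualD !hdual_mulE -tens_formDl.
by apply: eq_tens_form => // y; rewrite hdualD.
Qed.

Lemma hdual_mulDr : right_distributive hdual_mul +%R.
Proof.
move=> f g h; apply: hdualP => x; rewrite hdualD !hdual_mulE -tens_formDr.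
by apply: eq_tens_form => // y; rewrite hdualD.
Qed.

Lemma hdual_mulZl k f g : k *: hdual_mul f g = hdual_mul (k *: f) g.
Proof.
apply: hdualP => x; rewrite hdualZ !hdual_mulE -tens_formZl.
by apply: eq_tens_form => // y; rewrite hdualZ.
Qed.

Lemma hdual_mulZr k f g : k *: hdual_mul f g = hdual_mul f (k *: g).
Proof.
apply: hdualP => x; rewrite hdualZ !hdual_mulE -tens_formZr.
by apply: eq_tens_form => // y; rewrite hdualZ.
Qed.

Lemma hdual_one_neq0 : hdual_one != 0.
Proof.
apply/eqP => /(congr1 (fun f : hdual H => f 1)); rewrite hdual0 hdual_ofE rmorph1.
by apply/eqP; apply: oner_neq0.
Qed.

HB.instance Definition _ := GRing.Zmodule_isNzRing.Build (hdual H)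
  hdual_mulA hdual_mul1 hdual_mulr1 hdual_mulDl hdual_mulDr hdual_one_neq0.
HB.instance Definition _ :=
  GRing.Lmodule_isLalgebra.Build K (hdual H) hdual_mulZl.
HB.instance Definition _ :=
  GRing.Lalgebra_isAlgebra.Build K (hdual H) hdual_mulZr.
HB.instance Definition _ := Algebra_isFalgebra.Build K (hdual H).

Lemma hdualM f g x : (f * g) x = tens_form f g (comul x).
Proof. exact: hdual_mulE. Qed.

Lemma hdual1 x : (1 : hdual H) x = counit x.
Proof. exact: hdual_ofE. Qed.

Definition hdual_ev x f : K^o := f x.

Lemma hdual_ev_is_linear x : linear (hdual_ev x).
Proof. by move=> k f g; rewrite /hdual_ev hdualD hdualZ. Qed.
HB.instance Definition _ x := GRing.isLinear.Build K (hdual H) K^o *:%R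
  (hdual_ev x) (hdual_ev_is_linear x).

Lemma hdual_ev_sep f : (forall x, hdual_ev x f = 0) -> f = 0.
Proof. by move=> f0; apply: hdualP => x; rewrite hdual0; apply: f0. Qed.

(* [hdual_basis i] is the [i]-th vector of the basis of [hdual H] dual to
   [vecb]. *)
Lemma hdual_coord_is_linear i : linear (fun x : H => v2r x 0 i : K^o).
Proof. by move=> k x y; rewrite linearP !mxE. Qed.
Definition hdual_basis i : hdual H := hdual_of (HB.pack_for {linear H -> K^o}
  (fun x : H => v2r x 0 i : K^o)
  (GRing.isLinear.Build K H K^o *:%R _ (hdual_coord_is_linear i))).

Lemma hdual_basisE i x : hdual_basis i x = v2r x 0 i.
Proof. exact: hdual_ofE. Qed.

(* The transpose of the product of [H]; it is characterized by
   [hdual_comulE]. *)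
Definition hdual_comul f : tens (hdual H) (hdual H) :=
  \sum_i \sum_j f (vecb i * vecb j) *: tensv (hdual_basis i) (hdual_basis j).

Lemma hdual_comulE f x y :
  tens_form (hdual_ev x) (hdual_ev y) (hdual_comul f) = f (x * y).
Proof.
rewrite [in RHS](vecb_coord x) mulr_suml !linear_sum; apply: eq_bigr => i _.
rewrite [in RHS](vecb_coord y) mulr_sumr !linear_sum; apply: eq_bigr => j _.
rewrite linearZ /= tens_formE /= -scalerAl -scalerAr !hdual_linZ.
rewrite -[hdual_ev x _]/(hdual_basis i x) -[hdual_ev y _]/(hdual_basis j y).
by rewrite !hdual_basisE /GRing.scale /= mulrC -mulrA.
Qed.

Lemma hdual2P (s t : tens (hdual H) (hdual H)) :
  (forall x y, tens_form (hdual_ev x) (hdual_ev y) s =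
               tens_form (hdual_ev x) (hdual_ev y) t) -> s = t.
Proof.
by move=> st; apply: (tens_sep (phi := hdual_ev) (psi := hdual_ev)) st;
  apply: hdual_ev_sep.
Qed.

Lemma hdual3P (s t : tens (tens (hdual H) (hdual H)) (hdual H)) :
  (forall x y z,
     tens_form (tens_form (hdual_ev x) (hdual_ev y)) (hdual_ev z) s =
     tens_form (tens_form (hdual_ev x) (hdual_ev y)) (hdual_ev z) t) -> s = t.
Proof.
move=> st.
apply: (tens_sep (phi := fun xy : H * H =>
    tens_form (hdual_ev xy.1) (hdual_ev xy.2)) (psi := hdual_ev)).
- move=> u u0; apply: hdual2P => x y.
  by rewrite (u0 (x, y)) linear0.
- exact: hdual_ev_sep.
by move=> [x y] z; apply: st.
Qed.

Lemma hdual_comul_is_linear : linear hdual_comul.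
Proof.
move=> k f g; apply: hdual2P => x y.
rewrite linearP /= !hdual_comulE hdualD hdualZ.
by [].
Qed.

Lemma hdual_comulA f :
  tens_assoc (tens_map idfun hdual_comul (hdual_comul f)) =
  tens_map hdual_comul idfun (hdual_comul f).
Proof.
pose D : {linear hdual H -> tens (hdual H) (hdual H)} := HB.pack hdual_comul
  (GRing.isLinear.Build K _ _ *:%R hdual_comul hdual_comul_is_linear).
apply: hdual3P => x y z; rewrite tens_form_assoc.
rewrite (tens_form_map idfun D) (tens_form_map D idfun).
transitivity (tens_form (hdual_ev x) (hdual_ev (y * z)) (hdual_comul f)).
  by apply: eq_tens_form => g //=; rewrite hdual_comulE.
transitivity (tens_form (hdual_ev (x * y)) (hdual_ev z) (hdual_comul f)).
  by rewrite !hdual_comulE mulrA.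
by apply: eq_tens_form => g //=; rewrite hdual_comulE.
Qed.

Lemma hdual_comul1 : hdual_comul 1 = 1.
Proof.
apply: hdual2P => x y; rewrite hdual_comulE -tensv1 tens_formE /=.
by rewrite /hdual_ev !hdual1 rmorphM.
Qed.

Let pair2 (s t : tens (hdual H) (hdual H)) (X Y : tens H H) : K^o :=
  tens_lift (fun x1 x2 => tens_lift (fun y1 y2 =>
    (tens_form (hdual_ev x1) (hdual_ev y1) s : K) *
    tens_form (hdual_ev x2) (hdual_ev y2) t : K^o) Y) X.

Let pair2Dl s s' t X Y : pair2 (s + s') t X Y = pair2 s t X Y + pair2 s' t X Y.
Proof.
rewrite /pair2 /tens_lift -big_split; apply: eq_bigr => i _ /=.
rewrite -big_split; apply: eq_bigr => j _ /=; rewrite -scalerDr; congr (_ *: _).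
rewrite -big_split; apply: eq_bigr => k _ /=.
rewrite -big_split; apply: eq_bigr => l _ /=; rewrite -scalerDr; congr (_ *: _).
by rewrite linearD mulrDl.
Qed.

Let pair2Dr s t t' X Y : pair2 s (t + t') X Y = pair2 s t X Y + pair2 s t' X Y.
Proof.
rewrite /pair2 /tens_lift -big_split; apply: eq_bigr => i _ /=.
rewrite -big_split; apply: eq_bigr => j _ /=; rewrite -scalerDr; congr (_ *: _).
rewrite -big_split; apply: eq_bigr => k _ /=.
rewrite -big_split; apply: eq_bigr => l _ /=; rewrite -scalerDr; congr (_ *: _).
by rewrite linearD mulrDr.
Qed.

Let pair2v f1 f2 g1 g2 X Y :
  pair2 (tensv f1 f2) (tensv g1 g2) X Y =
  (tens_form f1 g1 X : K) * tens_form f2 g2 Y.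
Proof.
transitivity (tens_lift (fun x1 x2 => tens_lift (fun y1 y2 =>
    ((f1 x1 * f2 y1 : K) * (g1 x2 * g2 y2) : K^o)) Y) X : K^o).
  apply: eq_bigr => i _; apply: eq_bigr => j _; congr (_ *: _).
  apply: eq_bigr => k _; apply: eq_bigr => l _; congr (_ *: _).
  by rewrite !tens_formE.
rewrite /tens_form /tens_lift mulr_suml; apply: eq_bigr => i _ /=.
rewrite mulr_suml; apply: eq_bigr => j _ /=.
rewrite /GRing.scale /= -mulrA; congr (_ * _).
rewrite mulr_sumr; apply: eq_bigr => k _ /=.
rewrite mulr_sumr; apply: eq_bigr => l _ /=.
by rewrite [RHS]mulrCA; congr (_ * _); rewrite mulrACA.
Qed.

Let form_mul s t x y :
  tens_form (hdual_ev x) (hdual_ev y) (s * t) = pair2 s t (comul x) (comul y).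
Proof.
elim/tens_ind: s => [f1 f2|s s' ihs ihs']; last first.
  by rewrite mulrDl linearD /= ihs ihs' pair2Dl.
elim/tens_ind: t => [g1 g2|t t' iht iht']; last first.
  by rewrite mulrDr linearD /= iht iht' pair2Dr.
by rewrite tensvM tens_formE pair2v /= /hdual_ev !hdualM.
Qed.

Let pair2_comul f g X Y :
  pair2 (hdual_comul f) (hdual_comul g) X Y = tens_form f g (X * Y).
Proof.
apply: esym; rewrite [in LHS](tens_basis X) mulr_suml [LHS]linear_sum.
rewrite /pair2 [RHS]/tens_lift; apply: eq_bigr => i _.
rewrite mulr_suml [LHS]linear_sum; apply: eq_bigr => j _.
rewrite -scalerAl linearZ; congr (_ *: _).
rewrite [in LHS](tens_basis Y) mulr_sumr [LHS]linear_sum.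
rewrite [RHS]/tens_lift; apply: eq_bigr => k _.
rewrite mulr_sumr [LHS]linear_sum; apply: eq_bigr => l _.
rewrite -scalerAr linearZ; congr (_ *: _).
by rewrite tensvM /= tens_formE !hdual_comulE.
Qed.

Lemma hdual_comulM : {morph hdual_comul : f g / f * g}.
Proof.
move=> f g; apply: hdual2P => x y.
by rewrite form_mul pair2_comul hdual_comulE hdualM rmorphM.
Qed.

Lemma hdual_comul_monoid_morphism : monoid_morphism hdual_comul.
Proof. by split; [exact: hdual_comul1|exact: hdual_comulM]. Qed.

HB.instance Definition _ := GRing.isLinear.Build K (hdual H)
  (tens (hdual H) (hdual H)) *:%R hdual_comul hdual_comul_is_linear.
HB.instance Definition _ := GRing.isMonoidMorphism.Build (hdual H)
  (tens (hdual H) (hdual H)) hdual_comul hdual_comul_monoid_morphism.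

Definition hdual_counit f : K^o := f 1.

Lemma hdual_counit_is_linear : linear hdual_counit.
Proof. exact: hdual_ev_is_linear. Qed.

Lemma hdual_counit_monoid_morphism : monoid_morphism hdual_counit.
Proof.
split=> [|f g]; rewrite /hdual_counit; first by rewrite hdual1 rmorph1.
by rewrite hdualM rmorph1 -tensv1 tens_formE.
Qed.

HB.instance Definition _ := GRing.isLinear.Build K (hdual H) K^o *:%R
  hdual_counit hdual_counit_is_linear.
HB.instance Definition _ := GRing.isMonoidMorphism.Build (hdual H) K^o
  hdual_counit hdual_counit_monoid_morphism.

Definition hdual_antipode f : hdual H := hdual_of (f \o @antipode K H).

Lemma hdual_antipodeE f x : hdual_antipode f x = f (antipode x).
Proof. exact: hdual_ofE. Qed.

Lemma hdual_antipode_is_linear : linear hdual_antipode.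
Proof.
move=> k f g; apply: hdualP => x.
by rewrite hdualD hdualZ !hdual_antipodeE hdualD hdualZ.
Qed.

HB.instance Definition _ := GRing.isLinear.Build K (hdual H) (hdual H) *:%R
  hdual_antipode hdual_antipode_is_linear.

Lemma hdual_counitl f :
  tens_lift (fun g h => (hdual_counit g : K) *: h) (hdual_comul f) = f.
Proof.
apply: hdualP => x; rewrite -[in RHS](mul1r x) -hdual_comulE.
rewrite /tens_lift hdual_sum; apply: eq_bigr => i _.
by rewrite hdual_sum; apply: eq_bigr => j _; rewrite !hdualZ.
Qed.

Lemma hdual_counitr f :
  tens_lift (fun g h => (hdual_counit h : K) *: g) (hdual_comul f) = f.
Proof.
apply: hdualP => x; rewrite -[in RHS](mulr1 x) -hdual_comulE.
rewrite /tens_lift hdual_sum; apply: eq_bigr => i _.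
rewrite hdual_sum; apply: eq_bigr => j _; rewrite !hdualZ.
by rewrite /hdual_counit [f in _ * f]mulrC.
Qed.

Lemma tens_lift_exchange (U V U' V' : vectType K) (W : lmodType K)
    (F : U -> V -> U' -> V' -> W) s t :
  tens_lift (fun u v => tens_lift (F u v) t) s =
  tens_lift (fun u' v' => tens_lift (fun u v => F u v u' v') s) t.
Proof.
have E (U1 V1 U2 V2 : vectType K) (G : U1 -> V1 -> U2 -> V2 -> W) s1 s2 :
    tens_lift (fun u v => tens_lift (G u v) s2) s1 =
    \sum_p \sum_q (s1 p.1 p.2 * s2 q.1 q.2) *:
      G (vecb p.1) (vecb p.2) (vecb q.1) (vecb q.2).
  rewrite /tens_lift pair_bigA; apply: eq_bigr => p _ /=.
  rewrite pair_bigA scaler_sumr; apply: eq_bigr => q _ /=.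
  by rewrite scalerA.
rewrite !E exchange_big; apply: eq_bigr => p _; apply: eq_bigr => q _.
by rewrite mulrC.
Qed.

Let antipode_aux (A B : hdual H -> hdual H) (a b : H -> H) f :
    (forall g y, A g y = g (a y)) -> (forall g y, B g y = g (b y)) ->
    (forall x, tens_lift (fun y z => a y * b z) (comul x) = (counit x : K) *: 1) ->
  tens_lift (fun g h => A g * B h) (hdual_comul f) = (hdual_counit f : K) *: 1.
Proof.
move=> Aa Bb ab; apply: hdualP => x; rewrite hdualZ hdual1.
transitivity (tens_lift (fun g h => tens_lift (fun y z =>
    g (a y) * h (b z) : K^o) (comul x) : K^o) (hdual_comul f)).
  rewrite {1}/tens_lift hdual_sum; apply: eq_bigr => i _.
  rewrite hdual_sum; apply: eq_bigr => j _; rewrite hdualZ hdualM.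
  by congr (_ * _); apply: eq_bigr => k _; apply: eq_bigr => l _; rewrite Aa Bb.
rewrite tens_lift_exchange.
have <- : f ((counit x : K) *: 1) = hdual_counit f * counit x.
  by rewrite hdual_linZ mulrC.
rewrite -ab {1 3}/tens_lift linear_sum; apply: eq_bigr => i _.
rewrite linear_sum; apply: eq_bigr => j _; rewrite /= hdual_linZ.
by rewrite -hdual_comulE.
Qed.

Lemma hdual_antipodel f :
  tens_lift (fun g h => hdual_antipode g * h) (hdual_comul f) =
  (hdual_counit f : K) *: 1.
Proof.
apply: (antipode_aux (B := idfun) (b := idfun)) => // [g y|x].
  exact: hdual_antipodeE.
exact: antipodel.
Qed.

Lemma hdual_antipoder f :
  tens_lift (fun g h => g * hdual_antipode h) (hdual_comul f) =
  (hdual_counit f : K) *: 1.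
Proof.
apply: (antipode_aux (A := idfun) (a := idfun)) => // [g y|x].
  exact: hdual_antipodeE.
exact: antipoder.
Qed.

HB.instance Definition _ := Falgebra_isHopfAlgebra.Build K (hdual H)
  hdual_comulA hdual_counitl hdual_counitr hdual_antipodel hdual_antipoder.

End DualHopf.

Record nikshych_gens (A : Type) := NikshychGens {
  gen_e0 : A; gen_e1 : A;
  gen_ua : A; gen_ub : A;
  gen_va : A; gen_vb : A;
  gen_g : A
}.

Definition map_gens (A B : Type) (f : A -> B) (x : nikshych_gens A) :
    nikshych_gens B :=
  NikshychGens (f (gen_e0 x)) (f (gen_e1 x)) (f (gen_ua x)) (f (gen_ub x))
    (f (gen_va x)) (f (gen_vb x)) (f (gen_g x)).

Definition nikshych_relations (K : fieldType) (p : nat) (zeta : K)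
    (A : algType K) (x : nikshych_gens A) : Prop :=
  let: NikshychGens e0 e1 ua ub va vb g := x in
  [/\ [/\ e0 + e1 = 1, e0 * e1 = 0 & e1 * e0 = 0],
      [/\ ua ^+ p = e0, ub ^+ p = e0, e0 * ua = ua, e0 * ub = ub
        & ua * ub = ub * ua],
      [/\ va ^+ p = e1, vb ^+ p = e1, e1 * va = va, e1 * vb = vb
        & va * vb = zeta *: (vb * va)]
    & [/\ g ^+ 2 = 1, g * ua = ub * g, g * ub = ua * g, g * va = va * g
        & g * vb = vb * g]].

(* Universal property of the algebra presented by the generators [x] and the
   relations [nikshych_relations]. *)
Definition nikshych_presented (K : fieldType) (p : nat) (zeta : K)
    (A : algType K) (x : nikshych_gens A) : Prop :=
  nikshych_relations p zeta x /\
  forall (B : algType K) (y : nikshych_gens B),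
    nikshych_relations p zeta y ->
    exists f : {lrmorphism A -> B}, map_gens f x = y /\
      forall f' : {lrmorphism A -> B}, map_gens f' x = y -> f' =1 f.

(* In the corner with unit [e]: [u ^ 0] is [e], not the unit of [A]. *)
Definition corner_exp (A : pzSemiRingType) (e u : A) (n : nat) : A :=
  if n is 0 then e else u ^+ n.

Definition nikshych_comul_g (K : fieldType) (p : nat) (zeta : K)
    (H : falgType K) (x : nikshych_gens H) : tens H H :=
  let: NikshychGens e0 e1 ua ub va vb g := x in
  let gu (i j : nat) := g * corner_exp e0 ua i * corner_exp e0 ub j in
  let gv (i j : nat) := g * corner_exp e1 va i * corner_exp e1 vb j in
  (p%:R ^+ 2)^-1 *:
    (\sum_(i < p) \sum_(j < p) \sum_(k < p) \sum_(l < p)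
       zeta ^ (k%:Z * j%:Z - i%:Z * l%:Z) *: (gu i j \ox gu k l)) +
  p%:R^-1 *:
    (\sum_(k < p) \sum_(l < p)
       zeta ^ (- ((k%:Z + l%:Z) * k%:Z)) *:
         (gu k l \ox gv (k + l)%N (k + l)%N)) +
  p%:R^-1 *:
    (\sum_(k < p) \sum_(l < p)
       zeta ^ (k%:Z * (k%:Z + l%:Z)) *:
         (gv (k + l)%N (p.-1 * (k + l))%N \ox gu k l)) +
  p%:R^-1 *:
    (\sum_(k < p) \sum_(l < p) (gv k l \ox gv (p.-1 * l)%N k)).

Definition nikshych_hopf_structure (K : fieldType) (p : nat) (zeta : K)
    (H : hopfType K) (x : nikshych_gens H) : Prop :=
  let: NikshychGens e0 e1 ua ub va vb g := x in
  [/\ [/\ comul ua = (ua \ox ua) + (va \ox va),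
          comul ub = (ub \ox ub) + (vb \ox vb ^+ p.-1),
          comul va = (ua \ox va) + (va \ox ua),
          comul vb = (ub \ox vb) + (vb \ox ub ^+ p.-1)
        & comul g = nikshych_comul_g p zeta x],
      [/\ counit ua = 1, counit ub = 1, counit va = 0, counit vb = 0
        & counit g = 1]
    & [/\ antipode ua = ua ^+ p.-1, antipode ub = ub ^+ p.-1,
          antipode va = va ^+ p.-1, antipode vb = vb & antipode g = g]].

Definition is_nikshych (K : fieldType) (p : nat) (zeta : K) (H : hopfType K)
    (x : nikshych_gens H) : Prop :=
  nikshych_presented p zeta x /\ nikshych_hopf_structure p zeta x.

(* Main.v *)
Require Import Defs.
From HB Require Import structures.
From mathcomp Require Import all_boot all_order all_algebra all_field.
From mathcomp Require Import ring.

(** An algebra morphism [F] from [H] to its dual is the same thing as a bilinear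
    form [<y, z> = F y z] with [<y y', z> = <y \ox y', comul z>].  If this form
    is symmetric, the same identity with the two sides exchanged says that [F]
    is also a coalgebra morphism ([pairing_sym], [selfdual_comul],
    [selfdual_counit]), and a morphism of bialgebras commutes with the antipodes
    for free ([hopf_morphism_antipode]).  So the theorem amounts to finding a
    symmetric nondegenerate form for which [F] respects the defining relations.

    Let [U i j = ua^i ub^j] and [V i j = va^i vb^j] with exponents in the field
    ['F_p]; the products of [1] and [g] with these monomials span [H]
    ([mon_span]).  With [h = 1/2] in ['F_p] and [s] a square root of [p] in [K],
    the form is
      [<U i j, U k l> = zeta^(h ((i + j) k + (i - j) l))],
      [<V i j, g U k l> = <g U k l, V i j>
                        = zeta^(h (i j + (i - j) k + (i + j) l))],
      [<g V i j, g V k l> = s zeta^(h (i j + i k + j k))] if [j = l],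
    and zero on all other pairs of monomials; its symmetry is visible.

    Behind these formulas are three kinds of functionals.  [chi a b] is a
    character of the group algebra spanned by the [U i j], [W a b] is the same
    function carried by the [g U i j], and [G] is the quadratic character
    [zeta^(h i j)] on the [V i j] plus [s] times the indicator of [j = 0] on the
    [g V i j].  The images of the generators of [H] are found as follows.  The
    elements [ua + va] and [ua - va] are grouplike, so they must go to
    one-dimensional representations of [H], such as those whose half sum and
    half difference are [chi t t] and [W t t].  The elements [ub], [vb] and
    their inverses in the two corners form a comatrix, so they must go to the
    coefficients of a two-dimensional representation, such as [chi t (- t)] and
    [W (- t) t]; the parameter is the same because [G], the image of [g], has to
    exchange the images of [ua] and [ub] ([G_chi_swap]).  By [W_mul] the
    relation [va vb = zeta vb va] then says [4 t^2 = 1], which [t = h] fulfils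
    ([dual_rel]).  The value of [s] is what makes [G ^+ 2 = 1] on the [g U i j]
    ([conv_gVgV_axis]).

    Every functional needed is a matrix coefficient of an explicit
    representation ([induced_rel], [weyl_rel]), so linear independence of the
    monomials is a consequence rather than an ingredient.  Nondegeneracy is
    Fourier inversion on ['F_p] and on its square ([functionals_separate]). *)

Set Implicit Arguments.
Unset Strict Implicit.
Unset Printing Implicit Defensive.

Import GRing.Theory.
Local Open Scope ring_scope.

(** * Additive characters of the prime field *)

Section Characters.
Variables (p : nat) (p_prime : prime p) (K : fieldType) (zeta : K).
Hypothesis zeta_prim : p.-primitive_root zeta.

Definition fpchar (x : 'F_p) : K := zeta ^+ x.
Local Notation e := fpchar.

Lemma fpchar_nat n : e n%:R = zeta ^+ n.
Proof.
by rewrite /e val_Fp_nat // (prim_expr_mod zeta_prim).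
Qed.

Lemma fpcharD x y : e (x + y) = e x * e y.
Proof.
by rewrite -[x]natr_Zp -[y]natr_Zp -natrD !fpchar_nat exprD.
Qed.

Lemma fpchar0 : e 0 = 1. Proof. by rewrite -[0]/(0%:R) fpchar_nat. Qed.

Lemma fpchar1 : e 1 = zeta.
Proof. by rewrite -[1]/(1%:R) fpchar_nat. Qed.

Lemma fpchar_neq0 x : e x != 0.
Proof.
rewrite expf_neq0 //; apply/eqP => z0; have /eqP := prim_expr_order zeta_prim.
by rewrite z0 expr0n gtn_eqF ?prime_gt0 // eq_sym oner_eq0.
Qed.

Lemma fpchar_int (z : int) : e z%:~R = zeta ^ z.
Proof.
case: z => n; first exact: fpchar_nat.
rewrite NegzE mulrNz -[zeta ^ _]/(zeta ^- n.+1) -fpchar_nat.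
apply: (mulIf (fpchar_neq0 n.+1%:R)).
by rewrite -fpcharD addNr fpchar0 mulVf ?fpchar_neq0.
Qed.

Lemma fpchar_sum (y : 'F_p) :
  \sum_x e (x * y) = if y == 0 then p%:R else 0.
Proof.
case: eqP => [->|/eqP y0].
  rewrite (eq_bigr (fun=> 1)) => [|x _]; last by rewrite mulr0 fpchar0.
  by rewrite sumr_const card_Fp.
have ey : 1 - e y != 0.
  rewrite subr_eq0 eq_sym /e -(prim_order_dvd zeta_prim).
  apply: contra y0 => /dvdnP[k yk].
  by rewrite -[y]natr_Zp yk natrM pchar_Fp_0 // mulr0.
apply: (mulfI ey); rewrite mulr0 mulrBl mul1r mulr_sumr.
rewrite (reindex_inj (addIr 1)) /= -sumrB big1 // => x _.
by rewrite mulrDl mul1r fpcharD [_ * e y]mulrC subrr.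
Qed.

Lemma natr_predp : p.-1%:R = -1 :> 'F_p.
Proof.
apply/eqP; rewrite -subr_eq0 opprK natr1 prednK ?prime_gt0 //.
by rewrite pchar_Fp_0.
Qed.

Lemma natr_predM n : (p.-1 * n)%:R = - n%:R :> 'F_p.
Proof. by rewrite natrM natr_predp mulN1r. Qed.

Lemma sum_ordFp (M : nmodType) (f : 'F_p -> M) :
  \sum_(i < p) f i%:R = \sum_x f x.
Proof.
rewrite (reindex (fun x : 'F_p => cast_ord (Fp_cast p_prime) x)) /=.
  by apply: eq_bigr => x _; rewrite natr_Zp.
apply: onW_bij; exists (cast_ord (esym (Fp_cast p_prime))) => x;
  exact: val_inj.
Qed.

(** Induction along the cyclic group, started at [1] rather than [0]: the
    structure maps of [H] are given on [ua] and [ub], and reach [e0 = ua ^+ p]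
    only through the positive powers. *)
Lemma fp_ind (P : 'F_p -> Prop) :
  P 1 -> (forall x, P x -> P (x + 1)) -> forall x, P x.
Proof.
move=> P1 PS; have Pn n : P n.+1%:R.
  by elim: n => [//|n IH]; rewrite -natr1; apply: PS.
move=> x; have -> : x = (x + p.-1)%N.+1%:R :> 'F_p.
  by rewrite -natr1 natrD natr_Zp natr_predp subrK.
exact: Pn.
Qed.

End Characters.

(** * Monomials in an algebra satisfying the relations *)

(** The powers of a unit [u] of order [p] in the corner with unit [e], indexed
    by ['F_p] so that exponents obey field arithmetic.  The factor [e] matters
    for the exponent [0].  Locked, like the monomials below, so that rewriting
    with ring laws does not look inside. *)
HB.lock
Definition cpow (p : nat) (A : pzRingType) (e u : A) (x : 'F_p) : A :=
  e * u ^+ x.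

Section CornerPower.
Variables (p : nat) (p_prime : prime p) (A : pzRingType) (e u : A).
Hypotheses (eu : e * u = u) (up : u ^+ p = e).

Local Notation cpow := (@cpow p A e u).

Lemma corner_comm : u * e = u.
Proof. by rewrite -up -exprS exprSr up eu. Qed.

Lemma corner_idem : e * e = e.
Proof.
by rewrite -{2 3}up -(prednK (prime_gt0 p_prime)) exprS mulrA eu.
Qed.

Lemma corner_expE n : corner_exp e u n = e * u ^+ n.
Proof. by case: n => [|n] /=; rewrite ?mulr1 // exprS mulrA eu. Qed.

Lemma cpow_nat n : cpow n%:R = e * u ^+ n.
Proof.
rewrite cpow.unlock val_Fp_nat // {2}(divn_eq n p) exprD mulnC exprM up mulrA.
congr (_ * _); elim: (n %/ p)%N => [|k IH]; first by rewrite mulr1.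
by rewrite exprSr mulrA -IH corner_idem.
Qed.

Lemma cpow0 : cpow 0 = e.
Proof. by rewrite -[0]/(0%:R) cpow_nat mulr1. Qed.

Lemma cpow1 : cpow 1 = u.
Proof. by rewrite -[1]/(1%:R) cpow_nat eu. Qed.

Lemma cpow_predn : cpow (-1) = u ^+ p.-1.
Proof.
rewrite -(natr_predp p_prime) cpow_nat; have := prime_gt1 p_prime.
by case: (p) => [|[|n]] //= _; rewrite exprS mulrA eu.
Qed.

Lemma corner_unit n : u ^+ n * e = e * u ^+ n.
Proof.
elim: n => [|n IH]; first by rewrite mulr1 mul1r.
by rewrite exprS -mulrA IH mulrA corner_comm mulrA eu.
Qed.

Lemma cpowD x y : cpow (x + y) = cpow x * cpow y.
Proof.
rewrite -[x]natr_Zp -[y]natr_Zp -natrD !cpow_nat exprD -mulrA.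
by rewrite [_ * (e * _)]mulrA corner_unit !mulrA corner_idem.
Qed.

End CornerPower.

HB.lock
Definition monU (p : nat) (K : fieldType) (A : algType K) (x : nikshych_gens A)
    (i j : 'F_p) : A :=
  cpow (gen_e0 x) (gen_ua x) i * cpow (gen_e0 x) (gen_ub x) j.

HB.lock
Definition monV (p : nat) (K : fieldType) (A : algType K) (x : nikshych_gens A)
    (i j : 'F_p) : A :=
  cpow (gen_e1 x) (gen_va x) i * cpow (gen_e1 x) (gen_vb x) j.

Section Monomials.
Variables (p : nat) (p_prime : prime p) (K : fieldType) (zeta : K).
Hypothesis zeta_prim : p.-primitive_root zeta.
Variables (A : algType K) (x : nikshych_gens A).

Local Notation e := (fpchar zeta).
Local Notation U := (@monU p K A x).
Local Notation V := (@monV p K A x).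
Local Notation e0 := (gen_e0 x).
Local Notation e1 := (gen_e1 x).
Local Notation ua := (gen_ua x).
Local Notation ub := (gen_ub x).
Local Notation va := (gen_va x).
Local Notation vb := (gen_vb x).
Local Notation g := (gen_g x).

Implicit Types i j k l : 'F_p.

Hypothesis rel : nikshych_relations p zeta x.

Lemma rel_e : [/\ e0 + e1 = 1, e0 * e1 = 0 & e1 * e0 = 0].
Proof. by case: x rel => ? ? ? ? ? ? ? []. Qed.

Lemma rel_u : [/\ ua ^+ p = e0, ub ^+ p = e0, e0 * ua = ua, e0 * ub = ub
        & ua * ub = ub * ua].
Proof. by case: x rel => ? ? ? ? ? ? ? []. Qed.

Lemma rel_v : [/\ va ^+ p = e1, vb ^+ p = e1, e1 * va = va, e1 * vb = vb
        & va * vb = zeta *: (vb * va)].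
Proof. by case: x rel => ? ? ? ? ? ? ? []. Qed.

Lemma rel_g : [/\ g ^+ 2 = 1, g * ua = ub * g, g * ub = ua * g, g * va = va * g
        & g * vb = vb * g].
Proof. by case: x rel => ? ? ? ? ? ? ? []. Qed.

Lemma cpow_uC i j : cpow e0 ua i * cpow e0 ub j = cpow e0 ub j * cpow e0 ua i.
Proof.
case: rel_u => ua_p ub_p e_ua e_ub uC; rewrite cpow.unlock.
have cm m n : e0 * ua ^+ m * (e0 * ub ^+ n) = e0 * (ua ^+ m * ub ^+ n).
  by rewrite -mulrA [_ * (e0 * _)]mulrA (corner_unit e_ua ua_p) !mulrA
             (corner_idem p_prime e_ua ua_p).
have cm' m n : e0 * ub ^+ m * (e0 * ua ^+ n) = e0 * (ub ^+ m * ua ^+ n).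
  by rewrite -mulrA [_ * (e0 * _)]mulrA (corner_unit e_ub ub_p) !mulrA
             (corner_idem p_prime e_ub ub_p).
by rewrite cm cm'; congr (_ * _); apply: commrX; apply: commr_sym; apply: commrX.
Qed.

Lemma monU_mul i j k l : U i j * U k l = U (i + k) (j + l).
Proof.
case: rel_u => ua_p ub_p e_ua e_ub uC; rewrite monU.unlock.
rewrite (cpowD p_prime e_ua ua_p) (cpowD p_prime e_ub ub_p).
by rewrite -!mulrA [cpow e0 ub j * (cpow e0 ua k * _)]mulrA -cpow_uC -mulrA.
Qed.

Lemma cpow_vC i j :
  cpow e1 vb j * cpow e1 va i = e (- (i * j)) *: (cpow e1 va i * cpow e1 vb j).
Proof.
case: rel_v => va_p vb_p e_va e_vb vC.
rewrite -[i]natr_Zp -[j]natr_Zp; move: (i : nat) (j : nat) => {}i {}j.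
rewrite (cpow_nat p_prime e_va va_p) (cpow_nat p_prime e_vb vb_p).
have c1 m n : e1 * va ^+ m * (e1 * vb ^+ n) = e1 * (va ^+ m * vb ^+ n).
  by rewrite -mulrA [_ * (e1 * _)]mulrA (corner_unit e_va va_p) !mulrA
             (corner_idem p_prime e_va va_p).
have c2 m n : e1 * vb ^+ m * (e1 * va ^+ n) = e1 * (vb ^+ m * va ^+ n).
  by rewrite -mulrA [_ * (e1 * _)]mulrA (corner_unit e_vb vb_p) !mulrA
             (corner_idem p_prime e_vb vb_p).
have sw m n : va ^+ m * vb ^+ n = zeta ^+ (m * n) *: (vb ^+ n * va ^+ m).
  have sw1 (k : nat) : va * vb ^+ k = zeta ^+ k *: (vb ^+ k * va).
    elim: k => [|k IH]; first by rewrite mulr1 mul1r scale1r.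
    rewrite [in LHS]exprS mulrA vC -scalerAl -mulrA IH -scalerAr scalerA -exprS.
    by rewrite mulrA -exprS.
  elim: m => [|m IH]; first by rewrite mul0n mulr1 mul1r scale1r.
  rewrite [in LHS]exprSr -mulrA sw1 -scalerAr [in LHS]mulrA IH -scalerAl scalerA.
  by rewrite -mulrA -exprSr -exprD mulSn.
rewrite c1 c2 sw -!scalerAr scalerA -natrM -(fpchar_nat p_prime zeta_prim).
by rewrite -(fpcharD p_prime zeta_prim) addNr fpchar0 // scale1r.
Qed.

Lemma monV_mul i j k l : V i j * V k l = e (- (k * j)) *: V (i + k) (j + l).
Proof.
case: rel_v => va_p vb_p e_va e_vb vC; rewrite monV.unlock.
rewrite (cpowD p_prime e_va va_p) (cpowD p_prime e_vb vb_p).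
rewrite -[LHS]mulrA [cpow e1 vb j * (cpow e1 va k * _)]mulrA cpow_vC.
by rewrite -scalerAl -scalerAr !mulrA.
Qed.

Lemma mul_e0_monU i j : e0 * U i j = U i j.
Proof.
case: rel_u => ua_p _ e_ua _ _.
by rewrite monU.unlock cpow.unlock !mulrA (corner_idem p_prime e_ua ua_p).
Qed.

Lemma mul_e1_monV i j : e1 * V i j = V i j.
Proof.
case: rel_v => va_p _ e_va _ _.
by rewrite monV.unlock cpow.unlock !mulrA (corner_idem p_prime e_va va_p).
Qed.

Lemma monU_mul_e0 i j : U i j * e0 = U i j.
Proof.
case: rel_u => ua_p ub_p e_ua e_ub uC; rewrite monU.unlock cpow.unlock -!mulrA.
rewrite (corner_unit e_ub ub_p) [e0 * (e0 * _)]mulrA.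
by rewrite (corner_idem p_prime e_ub ub_p).
Qed.

Lemma monV_mul_e1 i j : V i j * e1 = V i j.
Proof.
case: rel_v => va_p vb_p e_va e_vb vC; rewrite monV.unlock cpow.unlock -!mulrA.
rewrite (corner_unit e_vb vb_p) [e1 * (e1 * _)]mulrA.
by rewrite (corner_idem p_prime e_vb vb_p).
Qed.

Lemma monUV i j k l : U i j * V k l = 0.
Proof.
case: rel_e => _ E _.
by rewrite -monU_mul_e0 -mul_e1_monV mulrA -(mulrA _ e0) E mulr0 mul0r.
Qed.

Lemma monVU i j k l : V i j * U k l = 0.
Proof.
case: rel_e => _ _ E.
by rewrite -monV_mul_e1 -mul_e0_monU mulrA -(mulrA _ e1) E mulr0 mul0r.
Qed.

Lemma monU00 : U 0 0 = e0.
Proof.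
by case: rel_u => *; rewrite monU.unlock !cpow0 // (@corner_idem p _ _ _ ua).
Qed.

Lemma monV00 : V 0 0 = e1.
Proof.
by case: rel_v => *; rewrite monV.unlock !cpow0 // (@corner_idem p _ _ _ va).
Qed.

Lemma monU10 : U 1 0 = ua.
Proof.
by case: rel_u => *; rewrite monU.unlock cpow0 // cpow1 // (@corner_comm p _ e0).
Qed.

Lemma monU01 : U 0 1 = ub.
Proof. by case: rel_u => *; rewrite monU.unlock cpow0 // cpow1. Qed.

Lemma monV10 : V 1 0 = va.
Proof.
by case: rel_v => *; rewrite monV.unlock cpow0 // cpow1 // (@corner_comm p _ e1).
Qed.

Lemma monV01 : V 0 1 = vb.
Proof. by case: rel_v => *; rewrite monV.unlock cpow0 // cpow1. Qed.

Lemma monU0N : U 0 (-1) = ub ^+ p.-1.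
Proof.
case: rel_u => ? ? ? ? _; rewrite -[RHS](@cpow_predn p _ _ e0) // monU.unlock.
by rewrite cpow0 // cpow.unlock mulrA (@corner_idem p _ _ _ ua).
Qed.

Lemma monV0N : V 0 (-1) = vb ^+ p.-1.
Proof.
case: rel_v => ? ? ? ? _; rewrite -[RHS](@cpow_predn p _ _ e1) // monV.unlock.
by rewrite cpow0 // cpow.unlock mulrA (@corner_idem p _ _ _ va).
Qed.

Lemma mulg_e0 : g * e0 = e0 * g.
Proof.
case: rel_u => ua_p ub_p _ _ _; case: rel_g => _ gua _ _ _.
rewrite -{1}ua_p -{1}ub_p; elim: p => [|n IH]; first by rewrite mulr1 mul1r.
by rewrite exprSr mulrA IH -mulrA gua mulrA -exprSr.
Qed.

Lemma mulg_e1 : g * e1 = e1 * g.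
Proof.
case: rel_e => E _ _; have -> : e1 = 1 - e0 by rewrite -E addrC addKr.
by rewrite mulrBr mulrBl mulr1 mul1r mulg_e0.
Qed.

Lemma mulg_monU i j : g * U i j = U j i * g.
Proof.
case: rel_g => _ gua gub _ _; rewrite monU.unlock cpow_uC cpow.unlock.
have ga n : g * ua ^+ n = ub ^+ n * g.
  elim: n => [|n IH]; first by rewrite mulr1 mul1r.
  by rewrite exprSr mulrA IH -mulrA gua mulrA -exprSr.
have gb n : g * ub ^+ n = ua ^+ n * g.
  elim: n => [|n IH]; first by rewrite mulr1 mul1r.
  by rewrite exprSr mulrA IH -mulrA gub mulrA -exprSr.
have ha n : g * (e0 * ua ^+ n) = e0 * ub ^+ n * g.
  by rewrite mulrA mulg_e0 -mulrA ga mulrA.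
have hb n : g * (e0 * ub ^+ n) = e0 * ua ^+ n * g.
  by rewrite mulrA mulg_e0 -mulrA gb mulrA.
by rewrite [LHS]mulrA hb -[LHS]mulrA ha mulrA.
Qed.

Lemma mulg_monV i j : g * V i j = V i j * g.
Proof.
case: rel_g => _ _ _ gva gvb; rewrite monV.unlock cpow.unlock.
have h w n : g * w = w * g -> g * (e1 * w ^+ n) = e1 * w ^+ n * g.
  by move=> gw; rewrite mulrA mulg_e1 -!mulrA; congr (_ * _); apply: commrX.
by rewrite [LHS]mulrA h // -[LHS]mulrA h // mulrA.
Qed.

Lemma gen_gK y : g * (g * y) = y.
Proof. by case: rel_g => E *; rewrite mulrA -expr2 E mul1r. Qed.

Lemma mon_one : 1 = U 0 0 + V 0 0.
Proof. by rewrite monU00 monV00; case: rel_e. Qed.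

End Monomials.

Lemma monU_map (p : nat) (K : fieldType) (A B : algType K)
    (f : {lrmorphism A -> B}) x (i j : 'F_p) :
  monU (map_gens f x) i j = f (monU x i j).
Proof. by rewrite monU.unlock cpow.unlock !rmorphM !rmorphXn. Qed.

Lemma monV_map (p : nat) (K : fieldType) (A B : algType K)
    (f : {lrmorphism A -> B}) x (i j : 'F_p) :
  monV (map_gens f x) i j = f (monV x i j).
Proof. by rewrite monV.unlock cpow.unlock !rmorphM !rmorphXn. Qed.

(** * Two families of matrix representations *)

Section Representations.
Variables (p : nat) (p_prime : prime p) (K : fieldType) (zeta : K).
Hypothesis zeta_prim : p.-primitive_root zeta.
Local Notation e := (fpchar zeta).
Implicit Types a b c d i j k l : 'F_p.

Definition diag2 a b : 'M[K]_2 :=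
  \matrix_(s, t) (if s == t then (if s == 0 then e a else e b) else 0).

Definition swap2 : 'M[K]_2 := \matrix_(s, t) (s != t)%:R.

Lemma diag2M a b c d : diag2 a b * diag2 c d = diag2 (a + c) (b + d).
Proof.
apply/matrixP => s t; rewrite !mxE big_ord_recl big_ord1 !mxE.
by case: s t => [[|[|s]] // ?] [[|[|t]] // ?] /=;
  rewrite ?mulr0 ?mul0r ?addr0 ?add0r ?fpcharD.
Qed.

Lemma diag2_1 : diag2 0 0 = 1.
Proof.
apply/matrixP => s t; rewrite !mxE fpchar0 //.
by case: s t => [[|[|s]] // ?] [[|[|t]] // ?].
Qed.

Lemma diag2X a b n : diag2 a b ^+ n = diag2 (a * n%:R) (b * n%:R).
Proof.
elim: n => [|n IH]; first by rewrite !mulr0 diag2_1.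
by rewrite exprSr IH diag2M -natr1 !mulrDr !mulr1.
Qed.

Lemma swap2_diag a b : swap2 * diag2 a b = diag2 b a * swap2.
Proof.
apply/matrixP => s t; rewrite !mxE !big_ord_recl !big_ord0 !mxE.
by case: s t => [[|[|s]] // ?] [[|[|t]] // ?] /=;
  rewrite ?mulr0 ?mul0r ?addr0 ?add0r ?mul1r ?mulr1.
Qed.

Lemma swap2K : swap2 ^+ 2 = 1.
Proof.
apply/matrixP => s t; rewrite expr2 !mxE !big_ord_recl !big_ord0 !mxE.
by case: s t => [[|[|s]] // ?] [[|[|t]] // ?] /=;
  rewrite ?mulr0 ?mul0r ?addr0 ?add0r ?mul1r ?mulr1.
Qed.

(** The representation induced from the character [ua |-> zeta^a],
    [ub |-> zeta^b] of the group algebra generated by [ua] and [ub]; [g]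
    exchanges the two basis vectors. *)
Definition induced_gens a b : nikshych_gens 'M[K]_2 :=
  NikshychGens 1 0 (diag2 a b) (diag2 b a) 0 0 swap2.

Lemma induced_rel a b : nikshych_relations p zeta (induced_gens a b).
Proof.
split=> /=.
- by rewrite addr0 mulr0 mul0r.
- rewrite !diag2X pchar_Fp_0 // !mulr0 diag2_1 !mul1r !diag2M.
  by rewrite [a + b]addrC.
- by rewrite expr0n gtn_eqF ?prime_gt0 // !mulr0 scaler0.
- by rewrite swap2K !swap2_diag !mulr0 !mul0r.
Qed.

Lemma induced_monU a b i j :
  monU (induced_gens a b) i j = diag2 (a * i + b * j) (b * i + a * j).
Proof. by rewrite monU.unlock cpow.unlock /= !mul1r !diag2X !natr_Zp diag2M. Qed.

Lemma induced_monV a b i j : monV (induced_gens a b) i j = 0.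
Proof. by rewrite monV.unlock cpow.unlock /= !mul0r. Qed.

Local Notation N := (Zp_trunc (pdiv p)).+2.

(** The Weyl operators: a cyclic shift by [i] after the diagonal operator with
    entries [zeta^(j t)]. *)
Definition weyl i j : 'M[K]_N :=
  \matrix_(s, t) if s == t - i :> 'F_p then e (j * t) else 0.

Lemma weylM i j k l : weyl i j * weyl k l = e (- (k * j)) *: weyl (i + k) (j + l).
Proof.
apply/matrixP => s t; rewrite !mxE (bigD1 (t - k)) //= big1 => [|r /negPf rtk].
  rewrite !mxE eqxx addr0 opprD [- i - k]addrC addrA.
  case: eqP => _; last by rewrite mul0r mulr0.
  by rewrite -!fpcharD //; congr e; ring.
by rewrite !mxE rtk mulr0.
Qed.

Lemma weyl1 : weyl 0 0 = 1.
Proof.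
apply/matrixP => s t; rewrite !mxE subr0 mul0r fpchar0 //.
by case: eqP.
Qed.

Lemma weyl_expl n : weyl 1 0 ^+ n = weyl n%:R 0.
Proof.
elim: n => [|n IH]; first by rewrite weyl1.
by rewrite exprSr IH weylM mulr0 oppr0 fpchar0 // scale1r addr0 -natr1.
Qed.

Lemma weyl_expr n : weyl 0 1 ^+ n = weyl 0 n%:R.
Proof.
elim: n => [|n IH]; first by rewrite weyl1.
by rewrite exprSr IH weylM mul0r oppr0 fpchar0 // scale1r addr0 -natr1.
Qed.

(** The irreducible representation of dimension [p] of the algebra generated by
    [va] and [vb], extended in two ways by a scalar action of [g]. *)
Definition weyl_gens (s : bool) : nikshych_gens 'M[K]_N :=
  NikshychGens 0 1 0 0 (weyl 1 0) (weyl 0 1) ((-1) ^+ s).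

Lemma weyl_rel s : nikshych_relations p zeta (weyl_gens s).
Proof.
split=> /=.
- by rewrite add0r mulr0 mul0r.
- by rewrite expr0n gtn_eqF ?prime_gt0 // !mulr0.
- rewrite weyl_expl weyl_expr pchar_Fp_0 // weyl1 !mul1r !weylM mulr0 mulr1 oppr0.
  split=> //; rewrite fpchar0 // scale1r scalerA !(addrC 0) !addr0.
  have -> : zeta * e (-1 : 'F_p) = 1.
    by rewrite -(fpchar0 p_prime zeta_prim) -(subrr 1) fpcharD // fpchar1.
  by rewrite scale1r.
- rewrite sqrr_sign !mulr0 !mul0r !mulr_sign.
  by case: s; rewrite ?mulrN ?mulNr ?mulr1 ?mul1r.
Qed.

Lemma weyl_monU s i j : monU (weyl_gens s) i j = 0.
Proof. by rewrite monU.unlock cpow.unlock /= !mul0r. Qed.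

Lemma weyl_monV s i j : monV (weyl_gens s) i j = weyl i j.
Proof.
rewrite monV.unlock cpow.unlock /= !mul1r weyl_expl weyl_expr !natr_Zp weylM.
by rewrite mul0r oppr0 fpchar0 // scale1r addr0 add0r.
Qed.

Variables (A : algType K) (x : nikshych_gens A).
Hypothesis pres : nikshych_presented p zeta x.
Hypothesis two_neq0 : 2%:R != 0 :> K.
Local Notation U := (monU x).
Local Notation V := (monV x).
Local Notation g := (gen_g x).

Lemma map_gen_g (B : algType K) (y : nikshych_gens B) (f : {lrmorphism A -> B}) :
  map_gens f x = y -> f g = gen_g y.
Proof. by move=> <-. Qed.

(** The first diagonal coefficient of the induced representation. *)
Lemma exists_induced_form a b : exists f : {linear A -> K^o},
  [/\ forall i j, f (U i j) = e (a * i + b * j), forall i j, f (g * U i j) = 0,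
      forall i j, f (V i j) = 0 & forall i j, f (g * V i j) = 0].
Proof.
have [r [rx _]] := pres.2 _ _ (induced_rel a b).
have rL : linear (fun y => r y 0 0 : K^o) by move=> k y z; rewrite linearP !mxE.
pose f : {linear A -> K^o} := HB.pack (fun y => r y 0 0 : K^o)
  (GRing.isLinear.Build K A K^o *:%R (fun y => r y 0 0 : K^o) rL).
have rU i j : r (U i j) = diag2 (a * i + b * j) (b * i + a * j).
  by rewrite -monU_map rx induced_monU.
have rV i j : r (V i j) = 0 by rewrite -monV_map rx induced_monV.
have rg y : r (g * y) = swap2 * r y.
  by rewrite rmorphM -[LHS]/(r g * r y) (map_gen_g rx).
exists f; split=> i j; rewrite -[f _]/(r _ 0 0) ?rg ?rU ?rV ?mulr0 ?mxE //=.
by rewrite !big_ord_recl big_ord0 !mxE /= mul0r mulr0 !addr0.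
Qed.

(** A linear form on matrices, with weights [w], applied to the average of the
    two Weyl representations: [g] acts by opposite signs in them, so that the
    average kills the [g V i j]. *)
Lemma exists_weyl_form (w : 'F_p -> 'F_p -> K) : exists f : {linear A -> K^o},
  [/\ forall i j, f (U i j) = 0, forall i j, f (g * U i j) = 0,
      forall i j, f (V i j) = \sum_t w (t - i) t * e (j * t)
    & forall i j, f (g * V i j) = 0].
Proof.
have [r [rx _]] := pres.2 _ _ (weyl_rel false).
have [r' [rx' _]] := pres.2 _ _ (weyl_rel true).
pose F (y : A) : K^o := 2%:R^-1 * \sum_s \sum_t w s t * (r y + r' y) s t.
have FL : linear F.
  move=> k y z; rewrite /F -[RHS]/(k * (_ * _) + _) mulrCA -mulrDr; congr (_ * _).
  rewrite mulr_sumr -big_split; apply: eq_bigr => s _ /=.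
  rewrite mulr_sumr -big_split; apply: eq_bigr => t _ /=.
  by rewrite !linearP !mxE; ring.
pose f : {linear A -> K^o} := HB.pack F (GRing.isLinear.Build K A K^o *:%R F FL).
have rU i j : r (U i j) = 0 by rewrite -monU_map rx weyl_monU.
have rU' i j : r' (U i j) = 0 by rewrite -monU_map rx' weyl_monU.
have rV i j : r (V i j) = weyl i j by rewrite -monV_map rx weyl_monV.
have rV' i j : r' (V i j) = weyl i j by rewrite -monV_map rx' weyl_monV.
have rg y : r (g * y) = r y.
  by rewrite rmorphM -[LHS]/(r g * r y) (map_gen_g rx) /= expr0 mul1r.
have rg' y : r' (g * y) = - r' y.
  by rewrite rmorphM -[LHS]/(r' g * r' y) (map_gen_g rx') /= expr1 mulN1r.
exists f; split=> i j;
  rewrite -[f _]/(F _) /F ?rg ?rg' ?rU ?rU' ?rV ?rV' ?oppr0 ?addr0.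
- by rewrite big1 ?mulr0 // => s _; rewrite big1 // => t _; rewrite mxE mulr0.
- by rewrite big1 ?mulr0 // => s _; rewrite big1 // => t _; rewrite mxE mulr0.
- rewrite exchange_big mulr_sumr; apply: eq_bigr => t _ /=.
  rewrite (bigD1 (t - i)) //= big1 ?addr0 => [|s /negPf si].
    by rewrite !mxE eqxx; field.
  by rewrite !mxE si addr0 mulr0.
- rewrite subrr.
  by rewrite big1 ?mulr0 // => s _; rewrite big1 // => t _; rewrite mxE mulr0.
Qed.

End Representations.

(** * The monomials span *)

Lemma relations_reflect (K : fieldType) (p : nat) (zeta : K) (A B : algType K)
    (f : {lrmorphism A -> B}) (x : nikshych_gens A) :
  injective f -> nikshych_relations p zeta (map_gens f x) ->
  nikshych_relations p zeta x.
Proof.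
move=> fI; case: x => e0 e1 ua ub va vb g /=.
rewrite /nikshych_relations /map_gens /=.
rewrite -!rmorphXn -!rmorphM -linearZ -rmorphD -(rmorph0 f) -(rmorph1 f).
case=> [[/fI-> /fI-> /fI->] [/fI-> /fI-> /fI-> /fI-> /fI->]
  [/fI-> /fI-> /fI-> /fI-> /fI->] [/fI-> /fI-> /fI-> /fI-> /fI->]].
by [].
Qed.

Section Generation.
Variables (p : nat) (p_prime : prime p) (K : fieldType) (zeta : K).
Hypothesis zeta_prim : p.-primitive_root zeta.
Variables (A : falgType K) (x : nikshych_gens A).
Hypothesis pres : nikshych_presented p zeta x.

Implicit Types a b i j : 'F_p.

Definition gens_seq : seq A :=
  [:: gen_e0 x; gen_e1 x; gen_ua x; gen_ub x; gen_va x; gen_vb x; gen_g x].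

(** The universal property makes the generators generate: the subalgebra [B]
    they span satisfies the relations, so there is a morphism to [B], and its
    composite with the inclusion is the identity by uniqueness. *)
Lemma presented_generated (S : {vspace A}) :
    1 \in S -> {in gens_seq & S, forall t y, t * y \in S} -> forall y, y \in S.
Proof.
move=> S1 Sx y; pose B := <<<<gens_seq>>>>%AS.
have BS : (B <= S)%VS.
  apply: agenv_sub_modl; first by rewrite -memvE.
  apply/prodvP => u v uX vS; rewrite (coord_span uX) mulr_suml.
  apply: memv_suml => i _; rewrite -scalerAl; apply: memvZ; apply: Sx => //.
  exact: mem_nth.
apply: (subvP BS).
have vsvalM : monoid_morphism (vsval : subvs_of B -> A).
  split=> //; apply/eqP; rewrite /= algid_eq1 memvE; exact: sub1_agenv.
have vsvalL : linear (vsval : subvs_of B -> A) by move=> k v w.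
pose i : {lrmorphism subvs_of B -> A} := HB.pack (vsval : subvs_of B -> A)
  (GRing.isMonoidMorphism.Build (subvs_of B) A (vsval : subvs_of B -> A) vsvalM)
  (GRing.isLinear.Build K (subvs_of B) A *:%R (vsval : subvs_of B -> A) vsvalL).
have XB t : t \in gens_seq -> t \in B.
  by move=> tX; apply: (subvP (sub_agenv _)); apply: memv_span.
pose z := map_gens (vsproj B) x.
have zx : map_gens vsval z = x.
  rewrite /z /map_gens /= !vsprojK; try by rewrite XB // !inE eqxx ?orbT.
  by case: (x).
have relz : nikshych_relations p zeta z.
  by apply: (relations_reflect (f := i)) subvs_inj _; rewrite zx; case: pres.
have [f [fx _]] := pres.2 _ _ relz.
have [k [_ uniq_k]] := pres.2 _ _ pres.1.
have -> : y = i (f y).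
  transitivity (k y); first by rewrite -(uniq_k idfun) //; case: (x).
  rewrite -(uniq_k (i \o f)) // -[RHS]zx -fx.
  by case: (x).
exact: subvsP.
Qed.

Local Notation U := (monU x).
Local Notation V := (monV x).
Local Notation g := (gen_g x).

Definition mon (t : bool * bool * 'F_p * 'F_p) : A :=
  let: (s, c, i, j) := t in g ^+ s * (if c then V i j else U i j).

Lemma nth_mon (n : 'I_#|{: bool * bool * 'F_p * 'F_p}|) :
  exists t, [seq mon t | t : bool * bool * 'F_p * 'F_p]`_n = mon t.
Proof.
have /imageP[t _ ->] : [seq mon t | t : bool * bool * 'F_p * 'F_p]`_n
    \in [seq mon t | t : bool * bool * 'F_p * 'F_p].
  by apply: mem_nth; rewrite size_image.
by exists t.
Qed.

Lemma mon_span y : y \in <<[seq mon t | t : bool * bool * 'F_p * 'F_p]>>%VS.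
Proof.
have rel := pres.1; set S := <<_>>%VS.
have mS t : mon t \in S by apply/memv_span/image_f.
have mU i j : U i j \in S by have := mS (false, false, i, j); rewrite /= mul1r.
have mV i j : V i j \in S by have := mS (false, true, i, j); rewrite /= mul1r.
have mgU i j : g * U i j \in S := mS (true, false, i, j).
have mgV i j : g * V i j \in S := mS (true, true, i, j).
have UU a b t : U a b * mon t \in S.
  case: t => [[[[] []] i] j] /=; rewrite ?mul1r ?expr1.
  - rewrite mulrA -(mulg_monU p_prime rel) -mulrA (monUV p_prime rel) mulr0.
    exact: mem0v.
  - by rewrite mulrA -(mulg_monU p_prime rel) -mulrA (monU_mul p_prime rel).
  - by rewrite (monUV p_prime rel) mem0v.
  - by rewrite (monU_mul p_prime rel).
have VV a b t : V a b * mon t \in S.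
  case: t => [[[[] []] i] j] /=; rewrite ?mul1r ?expr1.
  - rewrite mulrA -(mulg_monV rel) -mulrA (monV_mul p_prime zeta_prim rel).
    by rewrite -scalerAr; apply: memvZ.
  - by rewrite mulrA -(mulg_monV rel) -mulrA (monVU p_prime rel) mulr0 mem0v.
  - by rewrite (monV_mul p_prime zeta_prim rel); apply: memvZ.
  - by rewrite (monVU p_prime rel) mem0v.
have GG t : g * mon t \in S.
  case: t => [[[[] []] i] j] /=; rewrite ?mul1r ?expr1 ?(gen_gK rel) //.
apply: presented_generated => [|t {}y tX].
  by rewrite (mon_one p_prime rel); apply: memvD.
move=> /coord_span ->; rewrite mulr_sumr; apply: memv_suml => n _.
rewrite -scalerAr; apply: memvZ.
have [m ->] := nth_mon n.
move: tX; rewrite !inE -(monU00 p_prime rel) -(monV00 p_prime rel).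
rewrite -(monU10 p_prime rel) -(monU01 p_prime rel) -(monV10 p_prime rel).
rewrite -(monV01 p_prime rel).
by do 6![case/predU1P=> [-> //|]]; move/eqP=> ->.
Qed.

Lemma mon_ext (M : lmodType K) (f f' : A -> M) :
    linear f -> linear f' ->
    (forall i j, f (U i j) = f' (U i j)) ->
    (forall i j, f (g * U i j) = f' (g * U i j)) ->
    (forall i j, f (V i j) = f' (V i j)) ->
    (forall i j, f (g * V i j) = f' (g * V i j)) ->
  f =1 f'.
Proof.
move=> fl fl' fU fgU fV fgV y.
pose F : {linear A -> M} := HB.pack f (GRing.isLinear.Build K A M *:%R f fl).
pose F' : {linear A -> M} := HB.pack f' (GRing.isLinear.Build K A M *:%R f' fl').
rewrite -[LHS]/(F y) -[RHS]/(F' y) (coord_span (mon_span y)) !linear_sum.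
apply: eq_bigr => n _; rewrite !linearZ; congr (_ *: _).
have [m ->] := nth_mon n.
by case: m => [[[[] []] i] j] /=; rewrite ?mul1r ?expr1.
Qed.

End Generation.

(** * The comultiplication on monomials *)

Section Comul.
Variables (p : nat) (p_prime : prime p) (K : fieldType) (zeta : K).
Hypothesis zeta_prim : p.-primitive_root zeta.
Local Notation e := (fpchar zeta).
Implicit Types a b c d i j k l : 'F_p.
Variables (H : hopfType K) (x : nikshych_gens H).
Hypothesis rel : nikshych_relations p zeta x.
Hypothesis hopf : nikshych_hopf_structure p zeta x.

Local Notation U := (@monU p K H x).
Local Notation V := (@monV p K H x).
Local Notation g := (gen_g x).

Lemma comul_gens :
  [/\ comul (U 1 0) = (U 1 0 \ox U 1 0) + (V 1 0 \ox V 1 0),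
      comul (U 0 1) = (U 0 1 \ox U 0 1) + (V 0 1 \ox V 0 (-1)),
      comul (V 1 0) = (U 1 0 \ox V 1 0) + (V 1 0 \ox U 1 0),
      comul (V 0 1) = (U 0 1 \ox V 0 1) + (V 0 1 \ox U 0 (-1))
    & comul g = nikshych_comul_g p zeta x].
Proof.
rewrite (monU10 p_prime rel) (monU01 p_prime rel) (monV10 p_prime rel).
rewrite (monV01 p_prime rel).
rewrite (monU0N p_prime rel) (monV0N p_prime rel).
by case: x hopf => ? ? ? ? ? ? ? [].
Qed.

Lemma counit_gens :
  [/\ counit (U 1 0) = 1, counit (U 0 1) = 1, counit (V 1 0) = 0,
      counit (V 0 1) = 0 & counit g = 1].
Proof.
rewrite (monU10 p_prime rel) (monU01 p_prime rel) (monV10 p_prime rel).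
rewrite (monV01 p_prime rel).
by case: x hopf => ? ? ? ? ? ? ? [].
Qed.

Let UU := monU_mul p_prime rel.
Let VV := monV_mul p_prime zeta_prim rel.
Let UV := monUV p_prime rel.
Let VU := monVU p_prime rel.

Lemma counitU i j : counit (U i j) = 1.
Proof.
have [cua cub _ _ _] := counit_gens.
have cu k : counit (U k 0) = 1.
  elim/(fp_ind p_prime): k => // k IH; rewrite -[0]addr0 -UU rmorphM /= cua.
  by rewrite -[counit _]/(counit (U k 0)) IH mulr1.
have cu' k : counit (U 0 k) = 1.
  elim/(fp_ind p_prime): k => // k IH; rewrite -[0]addr0 -UU rmorphM /= cub.
  by rewrite -[counit _]/(counit (U 0 k)) IH mulr1.
by rewrite -[i]addr0 -[j]add0r -UU rmorphM /= cu cu' mulr1.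
Qed.

(** [counit e1 = 0] since [counit e0 = 1], and [V i j] lies in the corner of
    [e1]. *)
Lemma counitV i j : counit (V i j) = 0.
Proof.
have : counit (V 0 0) = 0.
  have /(congr1 (@counit K H)) := mon_one p_prime rel.
  rewrite rmorphD rmorph1 /= counitU => /eqP.
  by rewrite -subr_eq0 opprD addrA subrr add0r oppr_eq0 => /eqP.
have -> : V i j = V 0 0 * V i j.
  by rewrite VV mulr0 oppr0 fpchar0 // scale1r !add0r.
by rewrite rmorphM /= => ->; rewrite mul0r.
Qed.

Lemma counit_g y : counit (g * y) = counit y.
Proof. by case: counit_gens => _ _ _ _ cg; rewrite rmorphM /= cg mul1r. Qed.

(** The mixed terms vanish because the two corners annihilate each other, so the
    formula for a generator passes to its powers. *)
Lemma comulU i j : comul (U i j) = (U i j \ox U i j) + (V i j \ox V i (- j)).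
Proof.
have [cua cub _ _ _] := comul_gens.
have cu k : comul (U k 0) = (U k 0 \ox U k 0) + (V k 0 \ox V k 0).
  elim/(fp_ind p_prime): k => // k IH.
  rewrite -[X in U _ X]addr0 -UU rmorphM /= cua.
  rewrite IH mulrDl !mulrDr !tensvM !UU !UV !VU !VV mulr0 oppr0 fpchar0 //.
  by rewrite !scale1r tensv0l !addr0 add0r.
have cu' k : comul (U 0 k) = (U 0 k \ox U 0 k) + (V 0 k \ox V 0 (- k)).
  elim/(fp_ind p_prime): k => // k IH.
  rewrite -[X in U X _]addr0 -UU rmorphM /= cub.
  rewrite IH mulrDl !mulrDr !tensvM !UU !UV !VU !VV mul0r oppr0 fpchar0 //.
  by rewrite mul0r oppr0 fpchar0 // !scale1r tensv0l !addr0 add0r opprD.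
rewrite -[i in LHS]addr0 -[j in LHS]add0r -UU rmorphM /= cu cu'.
rewrite mulrDl !mulrDr !tensvM !UU !UV !VU !VV mulr0 oppr0 fpchar0 //.
by rewrite !scale1r tensv0l !addr0 !add0r.
Qed.

Lemma comulV i j : comul (V i j) = (U i j \ox V i j) + (V i j \ox U i (- j)).
Proof.
have [_ _ cva cvb _] := comul_gens.
have c0 : comul (V 0 0) = (U 0 0 \ox V 0 0) + (V 0 0 \ox U 0 0).
  have E := mon_one p_prime rel.
  have -> : V 0 0 = 1 - U 0 0 by rewrite E addrC addKr.
  rewrite rmorphB rmorph1 /= comulU oppr0 -tensv1.
  have -> : 1 - U 0 0 = V 0 0 by rewrite E addrC addKr.
  rewrite E tensvDl !tensvDr [(V 0 0 \ox U 0 0) + _]addrC addrACA.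
  by rewrite [LHS]addrC addKr.
have cv k : comul (V k 0) = (U k 0 \ox V k 0) + (V k 0 \ox U k 0).
  elim/(fp_ind p_prime): k => // k IH; rewrite -[X in V _ X]addr0.
  have -> : V (k + 1) (0 + 0) = V k 0 * V 1 0.
    by rewrite VV mulr0 oppr0 fpchar0 // scale1r.
  rewrite rmorphM /= cva IH mulrDl !mulrDr !tensvM !UU !UV !VU !VV.
  by rewrite mulr0 oppr0 fpchar0 // !scale1r !tensv0l !addr0 add0r.
have cv' k : comul (V 0 k) = (U 0 k \ox V 0 k) + (V 0 k \ox U 0 (- k)).
  elim/(fp_ind p_prime): k => // k IH; rewrite -[X in V X _]addr0.
  have -> : V (0 + 0) (k + 1) = V 0 k * V 0 1.
    by rewrite VV mul0r oppr0 fpchar0 // scale1r.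
  rewrite rmorphM /= cvb IH mulrDl !mulrDr !tensvM !UU !UV !VU !VV.
  by rewrite mul0r oppr0 fpchar0 // !scale1r !tensv0l !addr0 add0r opprD.
have -> : V i j = V i 0 * V 0 j.
  by rewrite VV mul0r oppr0 fpchar0 // scale1r addr0 add0r.
rewrite rmorphM /= cv cv' mulrDl !mulrDr !tensvM !UU !UV !VU !VV.
by rewrite mul0r oppr0 fpchar0 // !scale1r !tensv0l !addr0 !add0r.
Qed.

Lemma monU_corner (i j : nat) :
  g * corner_exp (gen_e0 x) (gen_ua x) i * corner_exp (gen_e0 x) (gen_ub x) j =
  g * U i%:R j%:R.
Proof.
by case: (rel_u rel) => *; rewrite monU.unlock -mulrA !corner_expE // !cpow_nat.
Qed.

Lemma monV_corner (i j : nat) :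
  g * corner_exp (gen_e1 x) (gen_va x) i * corner_exp (gen_e1 x) (gen_vb x) j =
  g * V i%:R j%:R.
Proof.
by case: (rel_v rel) => *; rewrite monV.unlock -mulrA !corner_expE // !cpow_nat.
Qed.

Lemma mul_sum2_tens (F : 'F_p -> 'F_p -> K) (X Y : 'F_p -> 'F_p -> H)
    (y z : H) :
  (\sum_k \sum_l F k l *: (X k l \ox Y k l)) * (y \ox z) =
  \sum_k \sum_l F k l *: ((X k l * y) \ox (Y k l * z)).
Proof.
rewrite mulr_suml; apply: eq_bigr => k _; rewrite mulr_suml; apply: eq_bigr => l _.
by rewrite -scalerAl tensvM.
Qed.

Lemma mul_sum4_tens (F : 'F_p -> 'F_p -> 'F_p -> 'F_p -> K)
    (X Y : 'F_p -> 'F_p -> H) (y z : H) :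
  (\sum_i \sum_j \sum_k \sum_l F i j k l *: (X i j \ox Y k l)) * (y \ox z) =
  \sum_i \sum_j \sum_k \sum_l F i j k l *: ((X i j * y) \ox (Y k l * z)).
Proof.
rewrite mulr_suml; apply: eq_bigr => i _; rewrite mulr_suml; apply: eq_bigr => j _.
exact: (mul_sum2_tens _ (fun _ _ => X i j)).
Qed.

Lemma sum2_0 (M : zmodType) (F : 'F_p -> 'F_p -> M) :
  (forall k l, F k l = 0) -> \sum_k \sum_l F k l = 0.
Proof. by move=> F0; rewrite big1 // => k _; rewrite big1. Qed.

(** The four components of [comul g] under the decomposition of the unit of
    [tens H H] by the corners of [e0] and [e1]; the scalar [1] in the last one
    gives it the shape of the other three. *)
Definition comul_g00 : tens H H := \sum_i \sum_j \sum_k \sum_l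
  e (k * j - i * l) *: ((g * U i j) \ox (g * U k l)).
Definition comul_g01 : tens H H := \sum_k \sum_l
  e (- ((k + l) * k)) *: ((g * U k l) \ox (g * V (k + l) (k + l))).
Definition comul_g10 : tens H H := \sum_k \sum_l
  e (k * (k + l)) *: ((g * V (k + l) (- (k + l))) \ox (g * U k l)).
Definition comul_g11 : tens H H := \sum_k \sum_l
  1 *: ((g * V k l) \ox (g * V (- l) k)).

Lemma comul_g : comul g =
  (p%:R ^+ 2)^-1 *: comul_g00 + p%:R^-1 *: comul_g01 +
  p%:R^-1 *: comul_g10 + p%:R^-1 *: comul_g11.
Proof.
have ez := fpchar_int p_prime zeta_prim.
case: comul_gens => _ _ _ _ ->; have CU := monU_corner; have CV := monV_corner.
move: CU CV; rewrite /nikshych_comul_g.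
rewrite /comul_g00 /comul_g01 /comul_g10 /comul_g11.
case: (x) => e0 e1 ua ub va vb h /= CU CV.
apply: (f_equal2 +%R (f_equal2 +%R (f_equal2 +%R (f_equal _ _)
  (f_equal _ _)) (f_equal _ _)) (f_equal _ _)).
- do 4![rewrite -[RHS](sum_ordFp p_prime); apply: eq_bigr => ? _].
  congr (_ *: (_ \ox _)); [|exact: CU|exact: CU].
  by rewrite -ez rmorphB !rmorphM.
- do 2![rewrite -[RHS](sum_ordFp p_prime); apply: eq_bigr => ? _].
  rewrite -natrD; congr (_ *: (_ \ox _)); [|exact: CU|exact: CV].
  by rewrite -ez rmorphN rmorphM rmorphD -natrD.
- do 2![rewrite -[RHS](sum_ordFp p_prime); apply: eq_bigr => ? _].
  rewrite -natrD -(natr_predM p_prime); congr (_ *: (_ \ox _)); [|exact: CV|exact: CU].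
  by rewrite -ez rmorphM rmorphD -natrD.
- do 2![rewrite -[RHS](sum_ordFp p_prime); apply: eq_bigr => ? _].
  by rewrite scale1r -(natr_predM p_prime); congr (_ \ox _); exact: CV.
Qed.

Lemma comul_g00V a b z : comul_g00 * (V a b \ox z) = 0.
Proof.
rewrite /comul_g00 mul_sum4_tens; apply: sum2_0 => i j; apply: sum2_0 => k l.
by rewrite -mulrA UV mulr0 tensv0l scaler0.
Qed.

Lemma comul_g01V a b z : comul_g01 * (V a b \ox z) = 0.
Proof.
rewrite /comul_g01 mul_sum2_tens; apply: sum2_0 => k l.
by rewrite -mulrA UV mulr0 tensv0l scaler0.
Qed.

Lemma comul_g01U a b y : comul_g01 * (y \ox U a b) = 0.
Proof.
rewrite /comul_g01 mul_sum2_tens; apply: sum2_0 => k l.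
by rewrite -[_ * V _ _ * _]mulrA VU mulr0 tensv0r scaler0.
Qed.

Lemma comul_g10U a b z : comul_g10 * (U a b \ox z) = 0.
Proof.
rewrite /comul_g10 mul_sum2_tens; apply: sum2_0 => k l.
by rewrite -[_ * V _ _ * _]mulrA VU mulr0 tensv0l scaler0.
Qed.

Lemma comul_g10V a b y : comul_g10 * (y \ox V a b) = 0.
Proof.
rewrite /comul_g10 mul_sum2_tens; apply: sum2_0 => k l.
by rewrite -[_ * U _ _ * _]mulrA UV mulr0 tensv0r scaler0.
Qed.

Lemma comul_g11U a b z : comul_g11 * (U a b \ox z) = 0.
Proof.
rewrite /comul_g11 mul_sum2_tens; apply: sum2_0 => k l.
by rewrite -[_ * V _ _ * U _ _]mulrA VU mulr0 tensv0l scaler0.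
Qed.

(** Of the four components of [comul g], the term [U \ox U] of [comul U] meets
    only the first and [V \ox V] only the last; for [comul V] it is the two
    middle ones. *)
Lemma comul_gU a b : comul (g * U a b) =
  (p%:R ^+ 2)^-1 *: (\sum_i \sum_j \sum_k \sum_l
     e (k * j - i * l) *: ((g * U (i + a) (j + b)) \ox (g * U (k + a) (l + b)))) +
  p%:R^-1 *: (\sum_k \sum_l
     e (- ((k + l) * a)) *: ((g * V (k + a) (l + b)) \ox (g * V (a - l) (k - b)))).
Proof.
rewrite rmorphM /= comulU comul_g !mulrDl !mulrDr -!scalerAl.
rewrite comul_g00V comul_g01V comul_g01U comul_g10U comul_g10V comul_g11U.
rewrite !scaler0 !addr0 !add0r /comul_g00 mul_sum4_tens /comul_g11 mul_sum2_tens.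
apply: (f_equal2 +%R (f_equal _ _) (f_equal _ _)).
  apply: eq_bigr => i _; apply: eq_bigr => j _.
  apply: eq_bigr => k _; apply: eq_bigr => l _.
  by rewrite -2!mulrA !UU.
apply: eq_bigr => k _; apply: eq_bigr => l _.
rewrite -2!mulrA !VV -!scalerAr tensvZl tensvZr !scalerA mul1r.
rewrite -fpcharD // [- l + a]addrC; congr (e _ *: _); ring.
Qed.

Lemma comul_gV a b : comul (g * V a b) =
  p%:R^-1 *: (\sum_k \sum_l e (- ((k + l) * (k + a))) *:
     ((g * U (k + a) (l + b)) \ox (g * V (k + l + a) (k + l + b)))) +
  p%:R^-1 *: (\sum_k \sum_l e ((k + l) * (k + a)) *:
     ((g * V (k + l + a) (b - (k + l))) \ox (g * U (k + a) (l - b)))).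
Proof.
rewrite rmorphM /= comulV comul_g !mulrDl !mulrDr -!scalerAl.
rewrite comul_g00V comul_g01V comul_g10U comul_g11U.
have -> : comul_g00 * (U a b \ox V a b) = 0.
  rewrite /comul_g00 mul_sum4_tens; apply: sum2_0 => i j; apply: sum2_0 => k l.
  by rewrite -[_ * U k l * _]mulrA UV mulr0 tensv0r scaler0.
have -> : comul_g11 * (V a b \ox U a (- b)) = 0.
  rewrite /comul_g11 mul_sum2_tens; apply: sum2_0 => k l.
  by rewrite -[_ * V (- l) k * _]mulrA VU mulr0 tensv0r scaler0.
rewrite !scaler0 !addr0 !add0r /comul_g01 mul_sum2_tens /comul_g10 mul_sum2_tens.
apply: (f_equal2 +%R (f_equal _ _) (f_equal _ _)).
  apply: eq_bigr => k _; apply: eq_bigr => l _.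
  rewrite -2!mulrA UU VV -scalerAr tensvZr scalerA.
  by rewrite -fpcharD //; congr (e _ *: _); ring.
apply: eq_bigr => k _; apply: eq_bigr => l _.
rewrite -2!mulrA UU VV -scalerAr tensvZl scalerA.
by rewrite -fpcharD // [- (k + l) + b]addrC; congr (e _ *: _); ring.
Qed.

End Comul.

(** * The convolution product on monomials *)

Section Convolution.
Variables (p : nat) (p_prime : prime p) (K : fieldType) (zeta : K).
Hypothesis zeta_prim : p.-primitive_root zeta.
Local Notation e := (fpchar zeta).
Implicit Types a b c d i j k l : 'F_p.
Variables (H : hopfType K) (x : nikshych_gens H).
Hypothesis rel : nikshych_relations p zeta x.
Hypothesis hopf : nikshych_hopf_structure p zeta x.

Local Notation U := (@monU p K H x).
Local Notation V := (@monV p K H x).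
Local Notation g := (gen_g x).
Implicit Types f : hdual H.

Lemma hdualM_monU f f' a b :
  (f * f') (U a b) = f (U a b) * f' (U a b) + f (V a b) * f' (V a (- b)).
Proof.
by rewrite hdualM (comulU p_prime zeta_prim rel hopf) linearD /= !tens_formE.
Qed.

Lemma hdualM_monV f f' a b :
  (f * f') (V a b) = f (U a b) * f' (V a b) + f (V a b) * f' (U a (- b)).
Proof.
by rewrite hdualM (comulV p_prime zeta_prim rel hopf) linearD /= !tens_formE.
Qed.

Lemma tens_form_sum2 f f' (F : 'F_p -> 'F_p -> K) (X Y : 'F_p -> 'F_p -> H) :
  tens_form f f' (\sum_k \sum_l F k l *: (X k l \ox Y k l)) =
  \sum_k \sum_l F k l * (f (X k l) * f' (Y k l)).
Proof.
rewrite linear_sum; apply: eq_bigr => k _; rewrite linear_sum; apply: eq_bigr => l _.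
by rewrite linearZ /= tens_formE.
Qed.

Lemma hdualM_gmonU f f' a b :
  (f * f') (g * U a b) =
  (p%:R ^+ 2)^-1 * (\sum_i \sum_j \sum_k \sum_l
     e (k * j - i * l) *
       (f (g * U (i + a) (j + b)) * f' (g * U (k + a) (l + b)))) +
  p%:R^-1 * (\sum_k \sum_l
     e (- ((k + l) * a)) *
       (f (g * V (k + a) (l + b)) * f' (g * V (a - l) (k - b)))).
Proof.
rewrite hdualM (comul_gU p_prime zeta_prim rel hopf) linearD !linearZ /=.
rewrite tens_form_sum2; congr (_ * _ + _).
rewrite linear_sum; apply: eq_bigr => i _; rewrite linear_sum; apply: eq_bigr => j _.
exact: (tens_form_sum2 _ _ _ (fun _ _ => g * U (i + a) (j + b))).
Qed.

Lemma hdualM_gmonV f f' a b :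
  (f * f') (g * V a b) =
  p%:R^-1 * (\sum_k \sum_l e (- ((k + l) * (k + a))) *
     (f (g * U (k + a) (l + b)) * f' (g * V (k + l + a) (k + l + b)))) +
  p%:R^-1 * (\sum_k \sum_l e ((k + l) * (k + a)) *
     (f (g * V (k + l + a) (b - (k + l))) * f' (g * U (k + a) (l - b)))).
Proof.
rewrite hdualM (comul_gV p_prime zeta_prim rel hopf) linearD !linearZ /=.
by rewrite !tens_form_sum2.
Qed.

End Convolution.

(** * Functionals given by their values on monomials *)

Section Fourier.
Variables (p : nat) (p_prime : prime p) (K : fieldType) (zeta : K).
Hypothesis zeta_prim : p.-primitive_root zeta.
Local Notation e := (fpchar zeta).
Implicit Types a b c i j k l : 'F_p.

Lemma sum_delta (M : nmodType) (F : 'F_p -> M) c :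
  \sum_k (if k == c then F k else 0) = F c.
Proof. by rewrite -big_mkcond big_pred1_eq. Qed.

Lemma fourier_delta (F : 'F_p -> K) c :
  \sum_k \sum_j F k * e (j * (k - c)) = p%:R * F c.
Proof.
rewrite (eq_bigr (fun k => if k == c then F k * p%:R else 0)) => [|k _].
  by rewrite sum_delta mulrC.
rewrite -mulr_sumr fpchar_sum // subr_eq0.
by case: eqP => _; rewrite ?mulr0.
Qed.

Lemma fourier_deltaN (F : 'F_p -> K) c :
  \sum_k \sum_j F k * e (j * (c - k)) = p%:R * F c.
Proof.
rewrite (eq_bigr (fun k => if k == c then F k * p%:R else 0)) => [|k _].
  by rewrite sum_delta mulrC.
rewrite -mulr_sumr fpchar_sum // subr_eq0 eq_sym.
by case: eqP => _; rewrite ?mulr0.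
Qed.

Lemma fourier2 a b i j :
  \sum_k \sum_l e (k * (i - a) + l * (j - b)) =
  if (i == a) && (j == b) then p%:R ^+ 2 else 0.
Proof.
transitivity ((\sum_k e (k * (i - a))) * \sum_l e (l * (j - b))).
  rewrite mulr_suml; apply: eq_bigr => k _; rewrite mulr_sumr.
  by apply: eq_bigr => l _; rewrite -fpcharD.
rewrite !fpchar_sum // !subr_eq0.
by case: eqP; case: eqP; rewrite ?mulr0 ?mul0r ?expr2.
Qed.

End Fourier.

Section Functionals.
Variables (p : nat) (p_prime : prime p) (K : fieldType) (zeta : K).
Hypothesis zeta_prim : p.-primitive_root zeta.
Hypothesis p_neq0 : p%:R != 0 :> K.
Local Notation e := (fpchar zeta).
Implicit Types a b c d i j k l : 'F_p.
Variables (H : hopfType K) (x : nikshych_gens H).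
Hypothesis pres : nikshych_presented p zeta x.
Hypothesis hopf : nikshych_hopf_structure p zeta x.

Local Notation U := (@monU p K H x).
Local Notation V := (@monV p K H x).
Local Notation g := (gen_g x).
Implicit Types f : hdual H.
Let rel := pres.1.

(** The values of a functional on the four families of spanning monomials.  They
    determine it ([hcoords_ext]), so an equality in the dual of [H] becomes an
    equality of four functions of two variables. *)
Definition hcoords f (cU cgU cV cgV : 'F_p -> 'F_p -> K) :=
  [/\ forall i j, f (U i j) = cU i j, forall i j, f (g * U i j) = cgU i j,
      forall i j, f (V i j) = cV i j & forall i j, f (g * V i j) = cgV i j].

Lemma hcoords_ext f f' cU cgU cV cgV :
  hcoords f cU cgU cV cgV -> hcoords f' cU cgU cV cgV -> f = f'.
Proof.
move=> [fU fgU fV fgV] [fU' fgU' fV' fgV']; apply: hdualP.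
have lf (f0 : hdual H) : linear (f0 : H -> K^o) by move=> k y z; rewrite linearP.
apply: (mon_ext p_prime zeta_prim pres (M := K^o) (lf f) (lf f')) => i j.
- by rewrite fU fU'.
- by rewrite fgU fgU'.
- by rewrite fV fV'.
- by rewrite fgV fgV'.
Qed.

Lemma hcoords_eq f cU cgU cV cgV cU' cgU' cV' cgV' :
    hcoords f cU cgU cV cgV ->
    (forall i j, cU i j = cU' i j) -> (forall i j, cgU i j = cgU' i j) ->
    (forall i j, cV i j = cV' i j) -> (forall i j, cgV i j = cgV' i j) ->
  hcoords f cU' cgU' cV' cgV'.
Proof.
move=> [fU fgU fV fgV] E1 E2 E3 E4.
by split=> i j; rewrite -?E1 -?E2 -?E3 -?E4.
Qed.

(** The convolution product seen on coordinates: the four components of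
    [comul g] give four twisted convolutions of functions on the square of
    ['F_p]. *)
Definition conv_gUgU (u v : 'F_p -> 'F_p -> K) a b :=
  (p%:R ^+ 2)^-1 * (\sum_i \sum_j \sum_k \sum_l
     e (k * j - i * l) * (u (i + a) (j + b) * v (k + a) (l + b))).
Definition conv_gVgV (u v : 'F_p -> 'F_p -> K) a b :=
  p%:R^-1 * (\sum_k \sum_l
     e (- ((k + l) * a)) * (u (k + a) (l + b) * v (a - l) (k - b))).
Definition conv_gUgV (u v : 'F_p -> 'F_p -> K) a b :=
  p%:R^-1 * (\sum_k \sum_l e (- ((k + l) * (k + a))) *
     (u (k + a) (l + b) * v (k + l + a) (k + l + b))).
Definition conv_gVgU (u v : 'F_p -> 'F_p -> K) a b :=
  p%:R^-1 * (\sum_k \sum_l e ((k + l) * (k + a)) *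
     (u (k + l + a) (b - (k + l)) * v (k + a) (l - b))).

Lemma hcoordsM f f' cU cgU cV cgV cU' cgU' cV' cgV' :
    hcoords f cU cgU cV cgV -> hcoords f' cU' cgU' cV' cgV' ->
  hcoords (f * f')
    (fun i j => cU i j * cU' i j + cV i j * cV' i (- j))
    (fun i j => conv_gUgU cgU cgU' i j + conv_gVgV cgV cgV' i j)
    (fun i j => cU i j * cV' i j + cV i j * cU' i (- j))
    (fun i j => conv_gUgV cgU cgV' i j + conv_gVgU cgV cgU' i j).
Proof.
move=> [fU fgU fV fgV] [fU' fgU' fV' fgV']; split=> a b.
- by rewrite (hdualM_monU p_prime zeta_prim rel hopf) fU fU' fV fV'.
- rewrite (hdualM_gmonU p_prime zeta_prim rel hopf); congr (_ * _ + _ * _).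
    apply: eq_bigr => i _; apply: eq_bigr => j _.
    by apply: eq_bigr => k _; apply: eq_bigr => l _; rewrite fgU fgU'.
  by apply: eq_bigr => k _; apply: eq_bigr => l _; rewrite fgV fgV'.
- by rewrite (hdualM_monV p_prime zeta_prim rel hopf) fU fU' fV fV'.
- rewrite (hdualM_gmonV p_prime zeta_prim rel hopf); congr (_ * _ + _ * _);
  by apply: eq_bigr => k _; apply: eq_bigr => l _; rewrite ?fgU ?fgV ?fgU' ?fgV'.
Qed.

Lemma hcoordsD f f' cU cgU cV cgV cU' cgU' cV' cgV' :
    hcoords f cU cgU cV cgV -> hcoords f' cU' cgU' cV' cgV' ->
  hcoords (f + f')
    (fun i j => cU i j + cU' i j) (fun i j => cgU i j + cgU' i j)
    (fun i j => cV i j + cV' i j) (fun i j => cgV i j + cgV' i j).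
Proof.
move=> [fU fgU fV fgV] [fU' fgU' fV' fgV'].
by split=> i j; rewrite hdualD ?fU ?fgU ?fV ?fgV ?fU' ?fgU' ?fV' ?fgV'.
Qed.

Lemma hcoordsZ (t : K) f cU cgU cV cgV :
    hcoords f cU cgU cV cgV ->
  hcoords (t *: f)
    (fun i j => t * cU i j) (fun i j => t * cgU i j)
    (fun i j => t * cV i j) (fun i j => t * cgV i j).
Proof.
by move=> [fU fgU fV fgV]; split=> i j; rewrite hdualZ ?fU ?fgU ?fV ?fgV.
Qed.

Lemma hcoords_sum I (r : seq I) (F : I -> hdual H) cU cgU cV cgV :
    (forall n, hcoords (F n) (cU n) (cgU n) (cV n) (cgV n)) ->
  hcoords (\sum_(n <- r) F n)
    (fun i j => \sum_(n <- r) cU n i j) (fun i j => \sum_(n <- r) cgU n i j)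
    (fun i j => \sum_(n <- r) cV n i j) (fun i j => \sum_(n <- r) cgV n i j).
Proof.
move=> FP; split=> i j; rewrite hdual_sum; apply: eq_bigr => n _;
  by case: (FP n) => fU fgU fV fgV; rewrite ?fU ?fgU ?fV ?fgV.
Qed.

Lemma hcoords1 :
  hcoords 1 (fun _ _ => 1) (fun _ _ => 1) (fun _ _ => 0) (fun _ _ => 0).
Proof.
split=> i j; rewrite hdual1 ?(counit_g p_prime rel hopf).
- exact: (counitU p_prime rel hopf).
- exact: (counitU p_prime rel hopf).
- exact: (counitV p_prime zeta_prim rel hopf).
- exact: (counitV p_prime zeta_prim rel hopf).
Qed.

(** A named zero function, so that the vanishing rules [conv0] below match
    syntactically. *)
Definition zero2 (i j : 'F_p) : K := 0.
Local Notation z2 := zero2.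

Lemma conv_gUgU0l v a b : conv_gUgU z2 v a b = 0.
Proof.
rewrite /conv_gUgU sum2_0 ?mulr0 // => i j; apply: sum2_0 => k l.
by rewrite mul0r mulr0.
Qed.

Lemma conv_gUgU0r u a b : conv_gUgU u z2 a b = 0.
Proof.
rewrite /conv_gUgU sum2_0 ?mulr0 // => i j; apply: sum2_0 => k l.
by rewrite !mulr0.
Qed.

Lemma conv_gVgV0l v a b : conv_gVgV z2 v a b = 0.
Proof. by rewrite /conv_gVgV sum2_0 ?mulr0 // => k l; rewrite mul0r mulr0. Qed.

Lemma conv_gVgV0r u a b : conv_gVgV u z2 a b = 0.
Proof. by rewrite /conv_gVgV sum2_0 ?mulr0 // => k l; rewrite !mulr0. Qed.

Lemma conv_gUgV0l v a b : conv_gUgV z2 v a b = 0.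
Proof. by rewrite /conv_gUgV sum2_0 ?mulr0 // => k l; rewrite mul0r mulr0. Qed.

Lemma conv_gUgV0r u a b : conv_gUgV u z2 a b = 0.
Proof. by rewrite /conv_gUgV sum2_0 ?mulr0 // => k l; rewrite !mulr0. Qed.

Lemma conv_gVgU0l v a b : conv_gVgU z2 v a b = 0.
Proof. by rewrite /conv_gVgU sum2_0 ?mulr0 // => k l; rewrite mul0r mulr0. Qed.

Lemma conv_gVgU0r u a b : conv_gVgU u z2 a b = 0.
Proof. by rewrite /conv_gVgU sum2_0 ?mulr0 // => k l; rewrite !mulr0. Qed.

Lemma zero2E i j : z2 i j = 0. Proof. by []. Qed.

Definition conv0 :=
  (conv_gUgU0l, conv_gUgU0r, conv_gVgV0l, conv_gVgV0r, conv_gUgV0l,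
   conv_gUgV0r, conv_gVgU0l, conv_gVgU0r, zero2E, (mul0r, mulr0), (addr0, add0r)).

Definition plane_wave a b i j := e (a * i + b * j).

Lemma plane_waveM a b c d i j :
  plane_wave a b i j * plane_wave c d i j = plane_wave (a + c) (b + d) i j.
Proof. by rewrite /plane_wave -fpcharD //; congr e; ring. Qed.

Lemma plane_wave0 i j : plane_wave 0 0 i j = 1.
Proof. by rewrite /plane_wave !mul0r addr0 fpchar0. Qed.

(** Summing over [l] forces the first index to be [d], summing over [j] forces
    the third to be [- b]; what remains is the value of the phase there.  The
    antisymmetric exponent is the source of the Weyl commutation relation in
    the dual. *)
Lemma conv_gUgU_wave a b c d i j :
  conv_gUgU (plane_wave a b) (plane_wave c d) i j =
  e (a * d - b * c) * plane_wave (a + c) (b + d) i j.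
Proof.
have p2 : (p%:R ^+ 2 : K) != 0 by rewrite expf_neq0.
apply: (mulfI p2); rewrite mulVKf //.
pose G s k := e (a * s + c * k + (a + c) * i + (b + d) * j).
transitivity (\sum_s \sum_l (p%:R * G s (- b)) * e (l * (d - s))).
  apply: eq_bigr => s _; rewrite -mulr_sumr -(fourier_delta p_prime zeta_prim).
  rewrite mulr_suml exchange_big; apply: eq_bigr => k _; rewrite mulr_suml.
  apply: eq_bigr => t _; rewrite mulr_sumr; apply: eq_bigr => l _.
  by rewrite /plane_wave /G -!fpcharD //; congr e; ring.
rewrite fourier_deltaN // expr2 -!mulrA; congr (_ * (_ * _)).
by rewrite /plane_wave /G -!fpcharD //; congr e; ring.
Qed.

Variables (h : 'F_p) (s : K).
Hypothesis ss : s * s = p%:R.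

Definition gauss_wave i j := e (h * (i * j)).
Definition axis_fun (i j : 'F_p) : K := if j == 0 then s else 0.
Definition axis_wave a b i j := if j == b - a then s * e (b * i) else 0.

Lemma gauss_wave_opp i j : gauss_wave i j * gauss_wave i (- j) = 1.
Proof.
rewrite /gauss_wave -fpcharD //; have -> : h * (i * j) + h * (i * - j) = 0 by ring.
exact: fpchar0.
Qed.

(** Only one pair of indices contributes, and the factor [s * s] cancels the
    normalization [p^-1]. *)
Lemma conv_gVgV_axis i j : conv_gVgV axis_fun axis_fun i j = 1.
Proof.
apply: (mulfI p_neq0); rewrite mulVKf // mulr1.
transitivity (\sum_k (if k == j then \sum_l (if l == - j
    then e (- ((k + l) * i)) * (s * s) else 0) else 0)).
  apply: eq_bigr => k _; rewrite /axis_fun subr_eq0.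
  case: (k == j); last by rewrite big1 // => l _; rewrite !mulr0.
  apply: eq_bigr => l _; rewrite addr_eq0.
  by case: (l == - j); rewrite // mul0r mulr0.
by rewrite !sum_delta subrr mul0r oppr0 fpchar0 // mul1r.
Qed.

(** The constraint from [axis_fun] eliminates [l], and the sum over [k] is then
    a character sum that vanishes unless [j = b - a].  The product in the other
    order ([conv_gUgV_axis]) gives the same result, which is why [G] commutes
    with every [W a b] ([G_W_comm]). *)
Lemma conv_gVgU_axis a b i j :
  conv_gVgU axis_fun (plane_wave a b) i j = axis_wave a b i j.
Proof.
apply: (mulfI p_neq0); rewrite mulVKf //.
transitivity (\sum_k \sum_l (if l == j - k
    then s * e ((j + a) * i) * e (k * (j - (b - a))) else 0)).
  apply: eq_bigr => k _; apply: eq_bigr => l _; rewrite /axis_fun.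
  have -> : (j - (k + l) == 0) = (l == j - k).
    by rewrite [RHS]eq_sym -[RHS]subr_eq0 opprD addrA.
  case: eqP => [->|_]; last by rewrite mul0r mulr0.
  rewrite mulrCA -mulrA; congr (s * _); rewrite /plane_wave -!fpcharD //.
  by congr e; ring.
under eq_bigr do rewrite sum_delta.
rewrite -mulr_sumr fpchar_sum // subr_eq0 /axis_wave.
case: eqP => [->|_]; last by rewrite !mulr0.
by rewrite mulrC subrK.
Qed.

Lemma conv_gUgV_axis a b i j :
  conv_gUgV (plane_wave a b) axis_fun i j = axis_wave a b i j.
Proof.
apply: (mulfI p_neq0); rewrite mulVKf //.
transitivity (\sum_k \sum_l (if l == - j - k
    then s * e ((j + a) * i) * e (k * (j - (b - a))) else 0)).
  apply: eq_bigr => k _; apply: eq_bigr => l _; rewrite /axis_fun.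
  have -> : (k + l + j == 0) = (l == - j - k).
    by rewrite -[RHS]subr_eq0; congr (_ == _); ring.
  case: eqP => [->|_]; last by rewrite !mulr0.
  rewrite [_ * s]mulrC mulrCA -mulrA; congr (s * _).
  by rewrite /plane_wave -!fpcharD //; congr e; ring.
under eq_bigr do rewrite sum_delta.
rewrite -mulr_sumr fpchar_sum // subr_eq0 /axis_wave.
case: eqP => [->|_]; last by rewrite !mulr0.
by rewrite mulrC subrK.
Qed.

End Functionals.

(** * The symmetric pairing *)

Section SelfDuality.
Variables (p : nat) (p_prime : prime p) (K : fieldType) (zeta : K).
Hypothesis zeta_prim : p.-primitive_root zeta.
Hypothesis p_neq0 : p%:R != 0 :> K.
Local Notation e := (fpchar zeta).
Implicit Types a b c d i j k l : 'F_p.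
Variables (H : hopfType K) (x : nikshych_gens H).
Hypothesis pres : nikshych_presented p zeta x.
Hypothesis hopf : nikshych_hopf_structure p zeta x.
Variables (h : 'F_p) (s : K).
Hypothesis hh : h + h = 1.
Hypothesis ss : s * s = p%:R.

Local Notation U := (@monU p K H x).
Local Notation V := (@monV p K H x).
Local Notation g := (gen_g x).
Local Notation z2 := (@zero2 p K).
Local Notation wave := (plane_wave zeta).
Local Notation gauss := (gauss_wave zeta h).
Local Notation line := (@axis_fun p K s).
Local Notation wline := (axis_wave zeta s).
Local Notation coords := (hcoords x).
Implicit Types f : hdual H.
Let rel := pres.1.

Variables (chi W : 'F_p -> 'F_p -> hdual H) (G : hdual H).
Hypothesis chiP : forall a b, coords (chi a b) (wave a b) z2 z2 z2.
Hypothesis WP : forall a b, coords (W a b) z2 (wave a b) z2 z2.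
Hypothesis GP : coords G z2 z2 gauss line.

Let cM := hcoordsM p_prime zeta_prim pres hopf.
Let cX := hcoords_ext p_prime zeta_prim pres.

Lemma chi_mul a b c d : chi a b * chi c d = chi (a + c) (b + d).
Proof.
apply: cX (hcoords_eq (cM (chiP a b) (chiP c d)) _ _ _ _) (chiP _ _) => i j;
  by rewrite !conv0 ?(plane_waveM p_prime zeta_prim).
Qed.

Lemma chi_mul_W a b c d : chi a b * W c d = 0.
Proof.
have c0 := hcoordsZ 0 (chiP a b); rewrite scale0r in c0.
apply: cX (cM (chiP a b) (WP c d)) (hcoords_eq c0 _ _ _ _) => i j;
  by rewrite !conv0.
Qed.

Lemma W_mul_chi a b c d : W a b * chi c d = 0.
Proof.
have c0 := hcoordsZ 0 (chiP a b); rewrite scale0r in c0.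
apply: cX (cM (WP a b) (chiP c d)) (hcoords_eq c0 _ _ _ _) => i j;
  by rewrite !conv0.
Qed.

Lemma W_mul a b c d : W a b * W c d = e (a * d - b * c) *: W (a + c) (b + d).
Proof.
apply: cX (hcoords_eq (cM (WP a b) (WP c d)) _ _ _ _)
  (hcoordsZ _ (WP _ _)) => i j;
  by rewrite !conv0 ?(conv_gUgU_wave p_prime zeta_prim p_neq0).
Qed.

Lemma chi_add_W : chi 0 0 + W 0 0 = 1.
Proof.
apply: cX (hcoords_eq (hcoordsD (chiP 0 0) (WP 0 0)) _ _ _ _)
  (hcoords1 p_prime zeta_prim pres hopf) => i j;
  by rewrite !conv0 ?(plane_wave0 p_prime zeta_prim).
Qed.

Lemma G_sqr : G ^+ 2 = 1.
Proof.
rewrite expr2; apply: cX (hcoords_eq (cM GP GP) _ _ _ _)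
  (hcoords1 p_prime zeta_prim pres hopf) => i j;
  by rewrite !conv0 ?(conv_gVgV_axis p_prime zeta_prim p_neq0 ss)
    ?(gauss_wave_opp p_prime zeta_prim).
Qed.

Lemma chi_mul_G a b :
  coords (chi a b * G) z2 z2 (fun i j => wave a b i j * gauss i j) z2.
Proof. by apply: hcoords_eq (cM (chiP a b) GP) _ _ _ _ => i j; rewrite !conv0. Qed.

Lemma G_mul_chi a b :
  coords (G * chi a b) z2 z2 (fun i j => gauss i j * wave a b i (- j)) z2.
Proof. by apply: hcoords_eq (cM GP (chiP a b)) _ _ _ _ => i j; rewrite !conv0. Qed.

Lemma W_mul_G a b : coords (W a b * G) z2 z2 z2 (wline a b).
Proof.
apply: hcoords_eq (cM (WP a b) GP) _ _ _ _ => i j;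
  by rewrite !conv0 ?(conv_gUgV_axis p_prime zeta_prim p_neq0).
Qed.

Lemma G_mul_W a b : coords (G * W a b) z2 z2 z2 (wline a b).
Proof.
apply: hcoords_eq (cM GP (WP a b)) _ _ _ _ => i j;
  by rewrite !conv0 ?(conv_gVgU_axis p_prime zeta_prim p_neq0).
Qed.

(** Conjugation by [G] negates the second parameter; it thus exchanges
    [chi h h] and [chi h (- h)], the images of [ua] and [ub]. *)
Lemma G_chi_swap a b : G * chi a b = chi a (- b) * G.
Proof.
apply: cX (G_mul_chi a b) (hcoords_eq (chi_mul_G a (- b)) _ _ _ _) => // i j.
by rewrite mulrC /plane_wave; congr (_ * e _); ring.
Qed.

Lemma G_W_comm a b : G * W a b = W a b * G.
Proof. exact: cX (G_mul_W a b) (W_mul_G a b). Qed.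

Lemma chi_exp a b n : chi a b ^+ n.+1 = chi (a * n.+1%:R) (b * n.+1%:R).
Proof.
elim: n => [|n IH]; first by rewrite !mulr1.
by rewrite exprSr IH chi_mul -[n.+2%:R]natr1 !mulrDr !mulr1.
Qed.

Lemma W_exp a b n : W a b ^+ n.+1 = W (a * n.+1%:R) (b * n.+1%:R).
Proof.
elim: n => [|n IH]; first by rewrite !mulr1.
rewrite exprSr IH W_mul -[n.+2%:R]natr1 !mulrDr !mulr1.
rewrite [X in e X](_ : _ = 0) ?fpchar0 ?scale1r //; ring.
Qed.

Lemma chi_exp_p a b : chi a b ^+ p = chi 0 0.
Proof.
have -> : chi a b ^+ p = chi a b ^+ p.-1.+1 by rewrite prednK ?prime_gt0.
by rewrite chi_exp prednK ?prime_gt0 // pchar_Fp_0 // !mulr0.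
Qed.

Lemma W_exp_p a b : W a b ^+ p = W 0 0.
Proof.
have -> : W a b ^+ p = W a b ^+ p.-1.+1 by rewrite prednK ?prime_gt0.
by rewrite W_exp prednK ?prime_gt0 // pchar_Fp_0 // !mulr0.
Qed.

Definition dual_gens : nikshych_gens (hdual H) :=
  NikshychGens (chi 0 0) (W 0 0) (chi h h) (chi h (- h)) (W h h) (W (- h) h) G.

(** The relation [va vb = zeta vb va] reads [e (h * h + h * h) =
    zeta * e (- (h * h) - h * h)], that is, [4 h^2 = 1]. *)
Lemma dual_rel : nikshych_relations p zeta dual_gens.
Proof.
split=> /=.
- by rewrite chi_add_W chi_mul_W W_mul_chi.
- rewrite !chi_exp_p !chi_mul !add0r.
  by rewrite [- h + h]addrC.
- rewrite !W_exp_p !W_mul !add0r !mul0r subrr fpchar0 //.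
  split; rewrite ?scale1r // scalerA [- h + h]addrC; congr (_ *: _).
  rewrite -{2}(fpchar1 p_prime zeta_prim) -fpcharD //; congr e.
  have -> : (1 : 'F_p) = (h + h) * (h + h) by rewrite hh mulr1.
  ring.
- by rewrite G_sqr !G_chi_swap opprK !G_W_comm.
Qed.

Definition hdelta a b i j : K := ((i == a) && (j == b))%:R.

Lemma sum_hdelta (M : lmodType K) (F : 'F_p -> 'F_p -> M) i j :
  \sum_a \sum_b hdelta a b i j *: F a b = F i j.
Proof.
rewrite (bigD1 i) //= [X in _ + X]big1 => [|a /negPf ai]; last first.
  by rewrite big1 // => b _; rewrite /hdelta eq_sym ai scale0r.
rewrite addr0 (bigD1 j) //= [X in _ + X]big1 => [|b /negPf bj]; last first.
  by rewrite /hdelta [j == b]eq_sym bj andbF scale0r.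
rewrite addr0 /hdelta !eqxx scale1r //.
Qed.

(** The functionals dual to the spanning monomials, by Fourier inversion. *)
Definition delta_U a b : hdual H :=
  (p%:R ^+ 2)^-1 *: \sum_k \sum_l e (- (k * a + l * b)) *: chi k l.
Definition delta_gU a b : hdual H :=
  (p%:R ^+ 2)^-1 *: \sum_k \sum_l e (- (k * a + l * b)) *: W k l.
Definition delta_V a b : hdual H :=
  (p%:R ^+ 2)^-1 *:
    \sum_k \sum_l e (- (k * a + l * b + h * (a * b))) *: (G * chi k (- l)).
Definition delta_gV a b : hdual H :=
  (p%:R * s)^-1 *: \sum_l e (- (l * a)) *: (G * W (l - b) l).

Lemma fourier2V a b i j :
  (p%:R ^+ 2)^-1 * \sum_k \sum_l e (k * (i - a) + l * (j - b)) = hdelta a b i j.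
Proof.
rewrite fourier2 // /hdelta; case: (_ && _); last by rewrite mulr0.
by rewrite mulVf ?expf_neq0.
Qed.

Lemma sum2_z0 (t : K) (F : 'F_p -> 'F_p -> K) i j :
  t * (\sum_k \sum_l F k l * z2 i j) = z2 i j.
Proof. by rewrite sum2_0 ?mulr0 // => *; rewrite mulr0. Qed.

Lemma delta_UP a b : coords (delta_U a b) (hdelta a b) z2 z2 z2.
Proof.
apply: hcoords_eq (hcoordsZ _ (hcoords_sum _ (fun k => hcoords_sum _
  (fun l => hcoordsZ _ (chiP k l))))) _ _ _ _ => i j; rewrite ?sum2_z0 //.
rewrite -fourier2V; congr (_ * _); apply: eq_bigr => k _; apply: eq_bigr => l _.
by rewrite -fpcharD //; congr e; ring.
Qed.

Lemma delta_gUP a b : coords (delta_gU a b) z2 (hdelta a b) z2 z2.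
Proof.
apply: hcoords_eq (hcoordsZ _ (hcoords_sum _ (fun k => hcoords_sum _
  (fun l => hcoordsZ _ (WP k l))))) _ _ _ _ => i j; rewrite ?sum2_z0 //.
rewrite -fourier2V; congr (_ * _); apply: eq_bigr => k _; apply: eq_bigr => l _.
by rewrite -fpcharD //; congr e; ring.
Qed.

Lemma delta_VP a b : coords (delta_V a b) z2 z2 (hdelta a b) z2.
Proof.
apply: hcoords_eq (hcoordsZ _ (hcoords_sum _ (fun k => hcoords_sum _
  (fun l => hcoordsZ _ (G_mul_chi k (- l)))))) _ _ _ _ => i j; rewrite ?sum2_z0 //.
have -> : hdelta a b i j = e (h * (i * j) - h * (a * b)) * hdelta a b i j.
  rewrite /hdelta; case: eqP => [->|_]; last by rewrite mulr0.
  case: eqP => [->|_]; last by rewrite mulr0.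
  by rewrite subrr fpchar0 // mulr1.
rewrite -fourier2V [RHS]mulrCA; congr (_ * _); rewrite mulr_sumr.
apply: eq_bigr => k _; rewrite mulr_sumr; apply: eq_bigr => l _.
by rewrite /gauss_wave /plane_wave -!fpcharD //; congr e; ring.
Qed.

Lemma s_neq0 : s != 0.
Proof. by apply: contraNneq p_neq0 => s0; rewrite -ss s0 mulr0. Qed.

Lemma delta_gVP a b : coords (delta_gV a b) z2 z2 z2 (hdelta a b).
Proof.
have z0 (t : K) (F : 'F_p -> K) i j : t * (\sum_l F l * z2 i j) = z2 i j.
  by rewrite big1 ?mulr0 // => *; rewrite mulr0.
apply: hcoords_eq (hcoordsZ _ (hcoords_sum _
  (fun l => hcoordsZ _ (G_mul_W (l - b) l)))) _ _ _ _ => i j; rewrite ?z0 //.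
transitivity ((p%:R * s)^-1 * (s * (j == b)%:R * \sum_l e (l * (i - a)))).
  congr (_ * _); rewrite mulr_sumr; apply: eq_bigr => l _.
  rewrite /axis_wave subKr; case: (j == b); last by rewrite !mulr0 mul0r.
  by rewrite mulrCA mulr1 -fpcharD //; congr (_ * e _); ring.
rewrite fpchar_sum // subr_eq0 /hdelta.
have s0 := s_neq0.
case: (i == a); last by rewrite !mulr0.
case: (j == b); rewrite ?mulr0 ?mul0r ?mulr0 //.
by rewrite mulr1 [s * _]mulrC mulVf // mulf_neq0.
Qed.

(** Reconstruction of [y] from its coordinates, which the [delta] functionals
    express through [chi], [W], [G * chi] and [G * W]. *)
Lemma functionals_separate y :
    (forall a b, chi a b y = 0) -> (forall a b, W a b y = 0) ->
    (forall a b, (G * chi a b) y = 0) -> (forall a b, (G * W a b) y = 0) ->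
  y = 0.
Proof.
move=> chi0 W0 Gchi0 GW0.
pose R z : H := \sum_a \sum_b (delta_U a b z : K) *: U a b +
  \sum_a \sum_b (delta_gU a b z : K) *: (g * U a b) +
  \sum_a \sum_b (delta_V a b z : K) *: V a b +
  \sum_a \sum_b (delta_gV a b z : K) *: (g * V a b).
have lin (D : 'F_p -> 'F_p -> hdual H) (F : 'F_p -> 'F_p -> H) :
  linear (fun z => \sum_a \sum_b (D a b z : K) *: F a b).
  move=> k u v; rewrite scaler_sumr -big_split; apply: eq_bigr => a _ /=.
  rewrite scaler_sumr -big_split; apply: eq_bigr => b _ /=.
  by rewrite linearP scalerDl scalerA.
have Rl : linear R.
  move=> k u v; rewrite /R !lin !scalerDr.
  by do 2![rewrite [RHS]addrACA; congr (_ + _)]; rewrite [RHS]addrACA.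
have lid : linear (@idfun H) by [].
have RE z (cU cgU cV cgV : 'F_p -> 'F_p -> K) :
    (forall a b, delta_U a b z = cU a b) -> (forall a b, delta_gU a b z = cgU a b) ->
    (forall a b, delta_V a b z = cV a b) -> (forall a b, delta_gV a b z = cgV a b) ->
  R z = \sum_a \sum_b cU a b *: U a b + \sum_a \sum_b cgU a b *: (g * U a b) +
    \sum_a \sum_b cV a b *: V a b + \sum_a \sum_b cgV a b *: (g * V a b).
  have es (F : 'F_p -> 'F_p -> H) (c c' : 'F_p -> 'F_p -> K) :
      (forall a b, c a b = c' a b) ->
      \sum_a \sum_b c a b *: F a b = \sum_a \sum_b c' a b *: F a b.
    by move=> E; apply: eq_bigr => a _; apply: eq_bigr => b _; rewrite E.
  move=> EU EgU EV EgV; rewrite /R.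
  by rewrite (es _ _ _ EU) (es _ _ _ EgU) (es _ _ _ EV) (es _ _ _ EgV).
have z0 (F : 'F_p -> 'F_p -> H) i j : \sum_a \sum_b z2 i j *: F a b = 0.
  by apply: sum2_0 => a b; rewrite scale0r.
have <- : R y = y.
  apply: (mon_ext p_prime zeta_prim pres Rl lid) => i j /=.
  - apply: etrans (RE _ (fun a b => hdelta a b i j) (fun=> fun=> z2 i j)
      (fun=> fun=> z2 i j) (fun=> fun=> z2 i j)
      (fun a b => let: And4 q _ _ _ := delta_UP a b in q i j)
      (fun a b => let: And4 q _ _ _ := delta_gUP a b in q i j)
      (fun a b => let: And4 q _ _ _ := delta_VP a b in q i j)
      (fun a b => let: And4 q _ _ _ := delta_gVP a b in q i j)) _.
    by rewrite /= sum_hdelta !z0 !addr0.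
  - apply: etrans (RE _ (fun=> fun=> z2 i j) (fun a b => hdelta a b i j)
      (fun=> fun=> z2 i j) (fun=> fun=> z2 i j)
      (fun a b => let: And4 _ q _ _ := delta_UP a b in q i j)
      (fun a b => let: And4 _ q _ _ := delta_gUP a b in q i j)
      (fun a b => let: And4 _ q _ _ := delta_VP a b in q i j)
      (fun a b => let: And4 _ q _ _ := delta_gVP a b in q i j)) _.
    by rewrite /= sum_hdelta !z0 !addr0 add0r.
  - apply: etrans (RE _ (fun=> fun=> z2 i j) (fun=> fun=> z2 i j)
      (fun a b => hdelta a b i j) (fun=> fun=> z2 i j)
      (fun a b => let: And4 _ _ q _ := delta_UP a b in q i j)
      (fun a b => let: And4 _ _ q _ := delta_gUP a b in q i j)
      (fun a b => let: And4 _ _ q _ := delta_VP a b in q i j)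
      (fun a b => let: And4 _ _ q _ := delta_gVP a b in q i j)) _.
    by rewrite /= sum_hdelta !z0 !addr0 add0r.
  - apply: etrans (RE _ (fun=> fun=> z2 i j) (fun=> fun=> z2 i j)
      (fun=> fun=> z2 i j) (fun a b => hdelta a b i j)
      (fun a b => let: And4 _ _ _ q := delta_UP a b in q i j)
      (fun a b => let: And4 _ _ _ q := delta_gUP a b in q i j)
      (fun a b => let: And4 _ _ _ q := delta_VP a b in q i j)
      (fun a b => let: And4 _ _ _ q := delta_gVP a b in q i j)) _.
    by rewrite /= sum_hdelta !z0 !addr0 add0r.
rewrite (RE y (fun=> fun=> 0) (fun=> fun=> 0) (fun=> fun=> 0) (fun=> fun=> 0)).
- by rewrite !(z0 _ 0 0) !addr0.
- move=> a b; rewrite hdualZ hdual_sum big1 ?mulr0 // => k _.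
  by rewrite hdual_sum big1 // => l _; rewrite hdualZ chi0 mulr0.
- move=> a b; rewrite hdualZ hdual_sum big1 ?mulr0 // => k _.
  by rewrite hdual_sum big1 // => l _; rewrite hdualZ W0 mulr0.
- move=> a b; rewrite hdualZ hdual_sum big1 ?mulr0 // => k _.
  by rewrite hdual_sum big1 // => l _; rewrite hdualZ Gchi0 mulr0.
- move=> a b; rewrite hdualZ hdual_sum big1 ?mulr0 // => k _.
  by rewrite hdualZ GW0 mulr0.
Qed.

Variable F : {lrmorphism H -> hdual H}.
Hypothesis Fx : map_gens F x = dual_gens.

Lemma chi_corner_exp a b n : chi 0 0 * chi a b ^+ n = chi (a * n%:R) (b * n%:R).
Proof.
case: n => [|n]; first by rewrite mulr1 !mulr0.
by rewrite chi_exp chi_mul !add0r.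
Qed.

Lemma W_corner_exp a b n : W 0 0 * W a b ^+ n = W (a * n%:R) (b * n%:R).
Proof.
case: n => [|n]; first by rewrite mulr1 !mulr0.
by rewrite W_exp W_mul !mul0r subrr fpchar0 // scale1r !add0r.
Qed.

Lemma selfdual_monU i j : F (U i j) = chi (h * (i + j)) (h * (i - j)).
Proof.
rewrite -monU_map Fx monU.unlock cpow.unlock /= !chi_corner_exp !natr_Zp.
by rewrite chi_mul; congr chi; ring.
Qed.

Lemma selfdual_monV i j : F (V i j) = gauss i j *: W (h * (i - j)) (h * (i + j)).
Proof.
rewrite -monV_map Fx monV.unlock cpow.unlock /= !W_corner_exp !natr_Zp W_mul.
rewrite /gauss_wave.
have -> : h * (i * j) = (h + h) * h * (i * j) by rewrite hh mul1r.
by congr (e _ *: W _ _); ring.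
Qed.

Lemma selfdual_g y : F (g * y) = G * F y.
Proof. by rewrite rmorphM; congr (_ * _); exact: (congr1 (@gen_g _) Fx). Qed.

Lemma selfdual_monU_coords i j :
  coords (F (U i j)) (wave (h * (i + j)) (h * (i - j))) z2 z2 z2.
Proof. by rewrite selfdual_monU. Qed.

Lemma selfdual_gmonU_coords i j : coords (F (g * U i j)) z2 z2
  (fun k l => gauss k l * wave (h * (i + j)) (h * (i - j)) k (- l)) z2.
Proof. by rewrite selfdual_g selfdual_monU; apply: G_mul_chi. Qed.

Lemma selfdual_monV_coords i j : coords (F (V i j)) z2
  (fun k l => gauss i j * wave (h * (i - j)) (h * (i + j)) k l) z2 z2.
Proof.
rewrite selfdual_monV.
by apply: hcoords_eq (hcoordsZ _ (WP _ _)) _ _ _ _ => k l; rewrite ?conv0.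
Qed.

Lemma selfdual_gmonV_coords i j : coords (F (g * V i j)) z2 z2 z2
  (fun k l => gauss i j * wline (h * (i - j)) (h * (i + j)) k l).
Proof.
rewrite selfdual_g selfdual_monV -scalerAr.
by apply: hcoords_eq (hcoordsZ _ (G_mul_W _ _)) _ _ _ _ => k l; rewrite ?conv0.
Qed.

(** On monomials, the exponents of the four coordinate tables above are
    symmetric in [(i, j)] and [(k, l)]; for the pairs [g V], on the support
    [j = l]. *)
Lemma pairing_sym y z : F y z = F z y.
Proof.
have linl w : linear (fun y => F y w : K^o).
  by move=> k u v; rewrite linearP hdualD hdualZ.
have linr w : linear (F w : H -> K^o) by move=> k u v; rewrite linearP.
have ext := mon_ext p_prime zeta_prim pres (M := K^o).
have symU i j : F (U i j) =1 F^~ (U i j).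
  have [EU EgU EV EgV] := selfdual_monU_coords i j.
  apply: (ext _ _ (linr _) (linl _)) => k l; rewrite ?EU ?EgU ?EV ?EgV.
  - by case: (selfdual_monU_coords k l) => -> _ _ _; congr e; ring.
  - by case: (selfdual_gmonU_coords k l) => -> _ _ _.
  - by case: (selfdual_monV_coords k l) => -> _ _ _.
  - by case: (selfdual_gmonV_coords k l) => -> _ _ _.
have symgU i j : F (g * U i j) =1 F^~ (g * U i j).
  have [EU EgU EV EgV] := selfdual_gmonU_coords i j.
  apply: (ext _ _ (linr _) (linl _)) => k l; rewrite ?EU ?EgU ?EV ?EgV.
  - by case: (selfdual_monU_coords k l) => _ -> _ _.
  - by case: (selfdual_gmonU_coords k l) => _ -> _ _.
  - case: (selfdual_monV_coords k l) => _ -> _ _; congr (_ * _).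
    by rewrite /plane_wave; congr e; ring.
  - by case: (selfdual_gmonV_coords k l) => _ -> _ _.
have symV i j : F (V i j) =1 F^~ (V i j).
  have [EU EgU EV EgV] := selfdual_monV_coords i j.
  apply: (ext _ _ (linr _) (linl _)) => k l; rewrite ?EU ?EgU ?EV ?EgV.
  - by case: (selfdual_monU_coords k l) => _ _ -> _.
  - case: (selfdual_gmonU_coords k l) => _ _ -> _; congr (_ * _).
    by rewrite /plane_wave; congr e; ring.
  - by case: (selfdual_monV_coords k l) => _ _ -> _.
  - by case: (selfdual_gmonV_coords k l) => _ _ -> _.
have hB a b : h * (a + b) - h * (a - b) = b.
  have -> : h * (a + b) - h * (a - b) = (h + h) * b by ring.
  by rewrite hh mul1r.
have symgV i j : F (g * V i j) =1 F^~ (g * V i j).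
  have [EU EgU EV EgV] := selfdual_gmonV_coords i j.
  apply: (ext _ _ (linr _) (linl _)) => k l; rewrite ?EU ?EgU ?EV ?EgV.
  - by case: (selfdual_monU_coords k l) => _ _ _ ->.
  - by case: (selfdual_gmonU_coords k l) => _ _ _ ->.
  - by case: (selfdual_monV_coords k l) => _ _ _ ->.
  - case: (selfdual_gmonV_coords k l) => _ _ _ ->.
    rewrite /axis_wave !hB eq_sym; case: eqP => [->|_]; last by rewrite !mulr0.
    rewrite !(mulrCA _ s) /gauss_wave -!fpcharD //.
    by congr (_ * e _); ring.
apply: (ext _ _ (linl z) (linr z)) => i j.
- exact: symU.
- exact: symgU.
- exact: symV.
- exact: symgV.
Qed.

(** By symmetry an element of the kernel is killed by the whole image of [F],
    and this image contains every functional of [functionals_separate]. *)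
Lemma selfdual_inj : injective F.
Proof.
apply: raddf_inj => y Fy0.
have Fy z : F z y = 0 by rewrite -pairing_sym Fy0 hdual0.
have hv a b : h * ((a + b) + (a - b)) = a.
  have -> : h * ((a + b) + (a - b)) = (h + h) * a by ring.
  by rewrite hh mul1r.
have hd a b : h * ((a + b) - (a - b)) = b.
  have -> : h * ((a + b) - (a - b)) = (h + h) * b by ring.
  by rewrite hh mul1r.
have chiE a b : chi a b = F (U (a + b) (a - b)) by rewrite selfdual_monU hv hd.
have WE a b : W a b = (gauss (b + a) (b - a))^-1 *: F (V (b + a) (b - a)).
  by rewrite selfdual_monV hv hd scalerK // fpchar_neq0.
apply: functionals_separate => a b; rewrite ?chiE ?WE.
- exact: Fy.
- by rewrite hdualZ Fy mulr0.
- by rewrite -selfdual_g Fy.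
- by rewrite -scalerAr hdualZ -selfdual_g Fy mulr0.
Qed.

Lemma selfdual_bij : bijective F.
Proof.
have dimE : \dim {: H} = \dim {: hdual H}.
  by rewrite !dimvf /dim /= muln1.
pose L : 'Hom(H, hdual H) := linfun F.
have LE y : L y = F y by exact: lfunE.
have L0 : lker L = 0%VS.
  apply/eqP/lker0P => y z; rewrite !LE; exact: selfdual_inj.
have Lf : limg L = fullv.
  apply/eqP; rewrite eqEdim subvf /= -dimE.
  by rewrite -(limg_ker_dim L fullv) L0 capv0 dimv0 add0n.
exists (L^-1)%VF => y.
  by rewrite -LE lker0_lfunK // L0.
by rewrite -LE limg_lfunVK // Lf memvf.
Qed.

(** Evaluated at [u \ox v], the left side is [<y, u v>] and the right side is
    [<u, y'> <v, y''>] summed over [comul y]: by symmetry this is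
    multiplicativity of [F]. *)
Lemma selfdual_comul y : comul (F y) = tens_map F F (comul y).
Proof.
apply: hdual2P => u v; rewrite hdual_comulE tens_form_map.
rewrite -pairing_sym rmorphM hdualM; apply: eq_tens_form => w /=.
  exact: pairing_sym.
exact: pairing_sym.
Qed.

Lemma selfdual_counit y : counit (F y) = counit y.
Proof. by rewrite -[LHS]/(F y 1) -pairing_sym rmorph1 hdual1. Qed.

End SelfDuality.

(** * Bialgebra morphisms preserve antipodes *)

Section Antipode.
Variables (K : fieldType) (H H' : hopfType K) (f : {lrmorphism H -> H'}).
Hypothesis f_comul : forall x, comul (f x) = tens_map f f (comul x).
Hypothesis f_counit : forall x, counit (f x) = counit x.

Lemma bilinear_comp (U V U' V' : vectType K) (W : lmodType K) (b : U' -> V' -> W)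
    (F : {linear U -> U'}) (F' : {linear V -> V'}) :
  bilinear_for *:%R *:%R b -> bilinear_for *:%R *:%R (fun u v => b (F u) (F' v)).
Proof.
by move=> [bl br]; split=> [v|u] a y z; rewrite linearP; [exact: bl | exact: br].
Qed.

Lemma eq_tens_lift (U V : vectType K) (W : lmodType K) (b b' : U -> V -> W) t :
  (forall u v, b u v = b' u v) -> tens_lift b t = tens_lift b' t.
Proof. by move=> E; apply: eq_bigr => i _; apply: eq_bigr => j _; rewrite E. Qed.

Lemma tens_lift_map (U V U' V' : vectType K) (W : lmodType K) (b : U' -> V' -> W)
    (F : {linear U -> U'}) (F' : {linear V -> V'}) t :
  bilinear_for *:%R *:%R b ->
  tens_lift b (tens_map F F' t) = tens_lift (fun u v => b (F u) (F' v)) t.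
Proof.
move=> bb; elim/tens_ind: t => [u v|y z IHy IHz]; last by rewrite !linearD /= IHy IHz.
by rewrite tens_mapE !tens_liftE //; apply: bilinear_comp.
Qed.

Lemma linear_tens_lift (U V : vectType K) (W W' : lmodType K) (b : U -> V -> W)
    (F : {linear W -> W'}) t :
  F (tens_lift b t) = tens_lift (fun u v => F (b u v)) t.
Proof.
rewrite linear_sum; apply: eq_bigr => i _; rewrite linear_sum; apply: eq_bigr => j _.
by rewrite linearZ.
Qed.

Lemma tens_lift_mull (U V : vectType K) (A : algType K) (c : A) (b : U -> V -> A) t :
  tens_lift (fun u v => c * b u v) t = c * tens_lift b t.
Proof.
rewrite mulr_sumr; apply: eq_bigr => i _; rewrite mulr_sumr.
by apply: eq_bigr => j _; rewrite scalerAr.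
Qed.

Lemma bilinear_tens_lift_assoc (U V V' : vectType K) (W : lmodType K)
    (b : tens U V -> V' -> W) : bilinear_for *:%R *:%R b ->
  bilinear_for *:%R *:%R (fun u => tens_lift (fun v w => b (u \ox v) w)).
Proof.
move=> [bl br]; split=> [t|u]; last exact: tens_lift_is_linear.
apply: tens_lift_linear_arg => v w a y z.
by rewrite tensvDl tensvZl bl.
Qed.

Lemma tens_lift_assoc (U V V' : vectType K) (W : lmodType K)
    (b : tens U V -> V' -> W) t : bilinear_for *:%R *:%R b ->
  tens_lift b (tens_assoc t) =
  tens_lift (fun u => tens_lift (fun v w => b (u \ox v) w)) t.
Proof.
move=> bb; elim/tens_ind: t => [u w|y z IHy IHz]; last by rewrite !linearD /= IHy IHz.
elim/tens_ind: w => [v w|y z IHy IHz]; last by rewrite tensvDr !linearD /= IHy IHz.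
rewrite tens_assocE !tens_liftE //; last exact: bilinear_tens_lift_assoc.
case: bb => bl br; split=> [w'|v'] a y z; last exact: br.
by rewrite tensvDr tensvZr bl.
Qed.

(** [f \o antipode] is a left inverse and [antipode \o f] a right inverse of [f]
    for convolution; [T], applied to the twofold coproduct of [x] bracketed in
    the two possible ways, gives one or the other. *)
Lemma hopf_morphism_antipode x : antipode (f x) = f (antipode x).
Proof.
pose L (y z : H) := f (antipode y) * f z.
have bL : bilinear_for *:%R *:%R L.
  split=> [v|u] a y z; rewrite /L /= !linearP.
    by rewrite mulrDl -scalerAl.
  by rewrite mulrDr -scalerAr.
pose T (t : tens H H) (z : H) := tens_lift L t * antipode (f z).
have bT : bilinear_for *:%R *:%R T.
  split=> [v|u] a y z; rewrite /T /= !linearP.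
    by rewrite mulrDl -scalerAl.
  by rewrite mulrDr -scalerAr.
have El y : tens_lift L (comul y) = (counit y : K) *: 1.
  have := congr1 f (antipodel y); rewrite linear_tens_lift linearZ rmorph1 => <-.
  by apply: eq_tens_lift => u v; rewrite rmorphM.
have Er y : tens_lift (fun u v => f u * antipode (f v)) (comul y) =
    (counit y : K) *: 1.
  rewrite -f_counit -antipoder f_comul tens_lift_map //.
  split=> [v|u] a w z; first by rewrite mulrDl -scalerAl.
  by rewrite linearP mulrDr -scalerAr.
have := congr1 (tens_lift T) (comulA x).
rewrite (tens_lift_map comul idfun) // tens_lift_assoc //.
rewrite (tens_lift_map idfun comul); last exact: bilinear_tens_lift_assoc.
rewrite [RHS](_ : _ = antipode (f x)); last first.
  rewrite -[in RHS](counitl x) !linear_tens_lift; apply: eq_tens_lift => u v.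
  by rewrite /T El -scalerAl mul1r !linearZ.
move=> <-; rewrite -[in RHS](counitr x) !linear_tens_lift.
apply: eq_tens_lift => u v.
transitivity (f (antipode u) *
    tens_lift (fun a b => f a * antipode (f b)) (comul v)).
  rewrite -tens_lift_mull; apply: eq_tens_lift => a b.
  by rewrite /T tens_liftE // mulrA.
by rewrite Er -scalerAr mulr1 !linearZ.
Qed.

End Antipode.

(** * Existence of the functionals *)

Section Existence.
Variables (p : nat) (p_prime : prime p) (K : fieldType) (zeta : K).
Hypothesis zeta_prim : p.-primitive_root zeta.
Hypothesis p_neq0 : p%:R != 0 :> K.
Hypothesis two_neq0 : 2%:R != 0 :> K.
Variables (H : hopfType K) (x : nikshych_gens H).
Hypothesis pres : nikshych_presented p zeta x.
Variables (h : 'F_p) (s : K).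
Hypothesis hh : h + h = 1.
Local Notation z2 := (@zero2 p K).

Lemma hcoords_shift (f : hdual H) (cU cgU cV cgV : 'F_p -> 'F_p -> K) :
  hcoords x f cU cgU cV cgV ->
  exists f' : hdual H, hcoords x f' cgU cU cgV cV.
Proof.
move=> [fU fgU fV fgV].
have L : linear (fun y => f (gen_g x * y) : K^o).
  by move=> k y z; rewrite mulrDr -scalerAr linearP.
exists (hdual_of (HB.pack (fun y => f (gen_g x * y) : K^o)
  (GRing.isLinear.Build K H K^o *:%R (fun y => f (gen_g x * y) : K^o) L))).
by split=> i j; rewrite hdual_ofE /= ?(gen_gK pres.1).
Qed.

Lemma chi_exists : exists chi : 'F_p -> 'F_p -> hdual H,
  forall a b, hcoords x (chi a b) (plane_wave zeta a b) z2 z2 z2.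
Proof.
have E (ab : 'F_p * 'F_p) : exists f : hdual H,
    hcoords x f (plane_wave zeta ab.1 ab.2) z2 z2 z2.
  have [f [fU fgU fV fgV]] :=
    exists_induced_form p_prime zeta_prim pres ab.1 ab.2.
  by exists (hdual_of f); split=> i j; rewrite hdual_ofE ?fU ?fgU ?fV ?fgV.
have [chi chiP] := fin_all_exists E.
by exists (fun a b => chi (a, b)) => a b; apply: (chiP (a, b)).
Qed.

Lemma W_exists : exists W : 'F_p -> 'F_p -> hdual H,
  forall a b, hcoords x (W a b) z2 (plane_wave zeta a b) z2 z2.
Proof.
have [chi chiP] := chi_exists.
have E (ab : 'F_p * 'F_p) : exists f : hdual H,
    hcoords x f z2 (plane_wave zeta ab.1 ab.2) z2 z2.
  exact: hcoords_shift (chiP ab.1 ab.2).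
have [W WP] := fin_all_exists E.
by exists (fun a b => W (a, b)) => a b; apply: (WP (a, b)).
Qed.

Lemma weyl_exists (w : 'F_p -> 'F_p -> K) : exists f : hdual H,
  hcoords x f z2 z2 (fun i j => \sum_t w (t - i) t * fpchar zeta (j * t)) z2.
Proof.
have [f [fU fgU fV fgV]] :=
  exists_weyl_form p_prime zeta_prim pres two_neq0 w.
by exists (hdual_of f); split=> i j; rewrite hdual_ofE ?fU ?fgU ?fV ?fgV.
Qed.

(** With the weights of the parity trace, the sum over [t] keeps the index with
    [t - i = - t], that is [t = h i], and yields [zeta^(h i j)]; with constant
    weights it is a character sum in [j]. *)
Lemma G_exists :
  exists G : hdual H, hcoords x G z2 z2 (gauss_wave zeta h) (@axis_fun p K s).
Proof.
have [f fP] := weyl_exists (fun u t => (u == - t)%:R).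
have [f0 f0P] := weyl_exists (fun _ _ => s / p%:R).
have [f' f'P] := hcoords_shift f0P.
exists (f + f'); apply: hcoords_eq (hcoordsD fP f'P) _ _ _ _ => i j.
- by rewrite /zero2 addr0.
- by rewrite /zero2 addr0.
- rewrite /zero2 addr0 (bigD1 (h * i)) //= [X in _ + X]big1 => [|t th].
    have -> : h * i - i == - (h * i).
      rewrite -addr_eq0; have -> : h * i - i + h * i = (h + h) * i - i by ring.
      by rewrite hh mul1r subrr.
    by rewrite mul1r addr0 /gauss_wave; congr fpchar; ring.
  rewrite (_ : _ == _ = false) ?mul0r //; apply: contraNF th => /eqP E.
  have Ei : i = t + t by rewrite -[t in _ + t]opprK -E; ring.
  have -> : h * i = (h + h) * t by rewrite Ei; ring.
  by rewrite hh mul1r.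
- rewrite /zero2 add0r -mulr_sumr /axis_fun.
  under eq_bigr do rewrite mulrC.
  rewrite fpchar_sum //; case: (j == 0); last by rewrite mulr0.
  by rewrite divfK.
Qed.

End Existence.

(** * The isomorphism *)

Theorem proposition4p2 (p : nat) (p_prime : prime p) (p_odd : odd p)
    (K : closedFieldType) (charK0 : [pchar K] =i pred0)
    (zeta : K) (zeta_prim : p.-primitive_root zeta)
    (H : hopfType K) (x : nikshych_gens H) (Hx : is_nikshych p zeta x) :
  hopf_isomorphic H (hdual H).
Proof.
have [pres hopf] := Hx.
have natK n : prime n -> n%:R != 0 :> K.
  by move=> n_prime; have := charK0 n; rewrite !inE n_prime => /negbT.
have p_neq0 := natK p p_prime; have two_neq0 := natK 2%N isT.
have [h hh] : exists h : 'F_p, h + h = 1.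
  exists (2%:R^-1); rewrite -mulr2n -[_ *+ 2]mulr_natr mulVf //.
  rewrite -(dvdn_pcharf (pchar_Fp p_prime)) dvdn_prime2 //.
  by apply: contraTneq p_odd => ->.
have [s ss] : exists s : K, s * s = p%:R.
  have [s E] := @solve_monicpoly K 2 (fun i => if i == 0 then p%:R else 0) isT.
  by exists s; rewrite -expr2 E big_ord_recl big_ord1 /= mul0r addr0 mulr1.
have [chi chiP] := chi_exists p_prime zeta_prim pres.
have [W WP] := W_exists p_prime zeta_prim pres.
have [G GP] := G_exists p_prime zeta_prim p_neq0 two_neq0 pres s hh.
have [F [Fx _]] := pres.2 _ _
  (dual_rel p_prime zeta_prim p_neq0 pres hopf hh ss chiP WP GP).
have Fd := selfdual_comul p_prime zeta_prim p_neq0 pres hopf hh chiP WP GP Fx.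
have Fe :=
  selfdual_counit p_prime zeta_prim p_neq0 pres hopf hh chiP WP GP Fx.
have Fb :=
  selfdual_bij p_prime zeta_prim p_neq0 pres hopf hh ss chiP WP GP Fx.
exists F; split=> //.
exact: hopf_morphism_antipode.
Qed.
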